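(* Let $\mathfrak K$ be a class of forcing notions each of which is proper for models of size $\omega_1$. Assume that $\mathrm{FA}(\mathfrak K,\omega_1)$ and $\mathrm{GMP}(\omega_2)$ hold. Then for every $\mathbb P\in\mathfrak K$, $\mathbb P$-$\mathrm{IGMP}(\omega_2)$ holds and $\mathbb P$ has the $\omega_1$-approximation property.
   Context: A set $x$ is bounded in $M$ if there is $X\in M$ with $x\subseteq X$. A set $M$ is $\omega_1$-guessing if for every $x$ bounded in $M$: $a\cap x\in M$ for all countable $a\in M$ if and only if there is $x^*\in M$ with $x^*\cap M=x\cap M$. A set $\mathcal S\subseteq\mathcal P_{\omega_2}(H_\theta)$ is stationary if for every $F:\mathcal P_\omega(H_\theta)\to\mathcal P_{\omega_2}(H_\theta)$ there is $M\in\mathcal S$, $M\prec H_\theta$, $M\cap\omega_2\in\omega_2$, closed under $F$. $\mathrm{GMP}(\omega_2)$: for every regular $\theta\geq\omega_2$, the set of $\omega_1$-guessing elementary submodels of $H_\theta$ of size $\omega_1$ is stationary in $\mathcal P_{\omega_2}(H_\theta)$. $\mathbb P$-$\mathrm{IGMP}(\omega_2)$ (for $\omega_1$-preserving $\mathbb P$): for every sufficiently large regular $\theta$, the set of $\omega_1$-guessing sets of size $\omega_1$ in $\mathcal P_{\omega_2}(H_\theta)$ which remain $\omega_1$-guessing after forcing with $\mathbb P$ is stationary. $\mathrm{FA}(\mathfrak K,\omega_1)$: for every $\mathbb P\in\mathfrak K$ and every family $\mathcal D$ of at most $\omega_1$ dense subsets of $\mathbb P$ there is a filter on $\mathbb P$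 meeting each member of $\mathcal D$. For $M\prec H_\theta$ with $\mathbb P,\mathcal P(\mathbb P)\in M$, $p$ is $(M,\mathbb P)$-generic if for every dense $D\subseteq\mathbb P$ in $M$, $M\cap D$ is predense below $p$. $\mathbb P$ is proper for models of size $\omega_1$ if for every sufficiently large regular $\theta$, every $M\prec(H_\theta,\in,\mathbb P)$ with $\omega_1\subseteq M$ and $|M|=\omega_1$, and every $p\in M\cap\mathbb P$, there is an $(M,\mathbb P)$-generic $q\leq p$. $\mathbb P$ has the $\omega_1$-approximation property if for every $V$-generic $G\subseteq\mathbb P$, every $x\in V[G]$ which is bounded in $V$ and satisfies $a\cap x\in V$ for all countable $a\in V$ belongs to $V$.
   Formalization: The class 𝔎 is additionally assumed closed under restriction to the conditions below any given p∈ℙ; without this the claim fails, e.g. for 𝔎 consisting only of the disjoint sum of a one-point order and Col(ω,ω1). *)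

(* Defs.v *)
(* Stdlib only. *)
From Stdlib Require Import Utf8 Classical ClassicalEpsilon Wellfounded.

Set Implicit Arguments.
Unset Strict Implicit.

(** * The set-theoretic universe *)

(* The axioms of ZFC, with "class" read as a Rocq predicate in separation and
   replacement.  Well-foundedness of membership is foundation for classes. *)
Record universe := Universe {
  set :> Type;
  mem : set -> set -> Prop;
  extensionality : forall x y, (forall z, mem z x <-> mem z y) -> x = y;
  foundation : well_founded mem;
  pairing : forall x y, exists p, forall z, mem z p <-> z = x \/ z = y;
  union : forall x, exists u, forall z, mem z u <-> exists y, mem y x /\ mem z y;
  power : forall x, exists u, forall z,
    mem z u <-> forall t, mem t z -> mem t x;
  infinity : exists u,
    (exists e, mem e u /\ forall z, ~ mem z e) /\
    (forall x, mem x u ->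
       exists s, mem s u /\ forall z, mem z s <-> mem z x \/ z = x);
  separation : forall (C : set -> Prop) x, exists u, forall z,
    mem z u <-> mem z x /\ C z;
  replacement : forall (R : set -> set -> Prop) x,
    (forall t y y', mem t x -> R t y -> R t y' -> y = y') ->
    exists u, forall y, mem y u <-> exists t, mem t x /\ R t y;
  choice : forall x,
    (forall y, mem y x -> exists z, mem z y) ->
    (forall y y' z, mem y x -> mem y' x -> mem z y -> mem z y' -> y = y') ->
    exists c, forall y, mem y x -> exists! z, mem z y /\ mem z c }.

Declare Scope set_theory_scope.
Delimit Scope set_theory_scope with ST.
Open Scope set_theory_scope.

Notation "x ∈ y" := (mem x y) (at level 70, no associativity) : set_theory_scope.

Definition sub (V : universe) (x y : V) : Prop := forall z, z ∈ x -> z ∈ y.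

Notation "x ⊆ y" := (sub x y) (at level 70, no associativity) : set_theory_scope.

Lemma universe_inhabited (V : universe) : inhabited V.
Proof. destruct (infinity V) as [u _]; exact (inhabits u). Qed.

Definition the (V : universe) (C : V -> Prop) : V :=
  epsilon (universe_inhabited V) C.

(* The set whose elements are exactly those of the class C; meaningful only if
   C is a set, as in all the uses below. *)
Definition setof (V : universe) (C : V -> Prop) : V :=
  the (fun s => forall x, x ∈ s <-> C x).

Definition cap (V : universe) (x y : V) : V := setof (fun z => z ∈ x /\ z ∈ y).

Notation "x ∩ y" := (cap x y) (at level 40, left associativity) : set_theory_scope.

Definition upair (V : universe) (x y : V) : V := setof (fun z => z = x \/ z = y).
Definition opair (V : universe) (x y : V) : V := upair (upair x x) (upair x y).
Definition powerset (V : universe) (x : V) : V := setof (fun z => z ⊆ x).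

(** * Cardinals and H_θ *)

(* By replacement, a Rocq function restricted to a set is a set. *)
Definition card_le (V : universe) (x y : V) : Prop :=
  exists f : V -> V,
    (forall z, z ∈ x -> f z ∈ y) /\
    (forall z z', z ∈ x -> z' ∈ x -> f z = f z' -> z = z').

Definition card_lt (V : universe) (x y : V) : Prop :=
  card_le x y /\ ~ card_le y x.

Definition card_eq (V : universe) (x y : V) : Prop :=
  exists f : V -> V,
    (forall z, z ∈ x -> f z ∈ y) /\
    (forall z z', z ∈ x -> z' ∈ x -> f z = f z' -> z = z') /\
    (forall w, w ∈ y -> exists z, z ∈ x /\ f z = w).

Definition transitive (V : universe) (x : V) : Prop := forall y, y ∈ x -> y ⊆ x.

Definition ordinal (V : universe) (x : V) : Prop :=
  transitive x /\ forall y, y ∈ x -> transitive y.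

Definition cardinal (V : universe) (x : V) : Prop :=
  ordinal x /\ forall y, y ∈ x -> ~ card_le x y.

Definition inductive_set (V : universe) (x : V) : Prop :=
  (exists e, e ∈ x /\ forall z, ~ z ∈ e) /\
  (forall y, y ∈ x -> exists s, s ∈ x /\ forall z, z ∈ s <-> z ∈ y \/ z = y).

Definition omega {V : universe} : V :=
  setof (fun n => forall x, inductive_set x -> n ∈ x).

Definition countable (V : universe) (x : V) : Prop := card_le x omega.

(* The set of ordinals that inject into x; for a cardinal x this is x^+. *)
Definition hartogs (V : universe) (x : V) : V :=
  setof (fun a => ordinal a /\ card_le a x).

Definition omega1 {V : universe} : V := hartogs omega.
Definition omega2 {V : universe} : V := hartogs omega1.

Definition regular (V : universe) (θ : V) : Prop :=
  cardinal θ /\ omega ⊆ θ /\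
  forall x, x ⊆ θ -> card_lt x θ -> exists b, b ∈ θ /\ forall a, a ∈ x -> a ∈ b.

Definition trcl (V : universe) (x : V) : V :=
  setof (fun z => forall t, transitive t -> x ⊆ t -> z ∈ t).

Definition H (V : universe) (θ : V) : V := setof (fun x => card_lt (trcl x) θ).

Definition P_ (V : universe) (κ x : V) : V :=
  setof (fun y => y ⊆ x /\ card_lt y κ).

Definition for_large_regular (V : universe) (Q : V -> Prop) : Prop :=
  exists κ : V, ordinal κ /\ forall θ, regular θ -> κ ∈ θ -> Q θ.

(** * Elementary submodels *)

Inductive formula : Type :=
| FMem (i j : nat)
| FEq (i j : nat)
| FNot (A : formula)
| FAnd (A B : formula)
| FEx (i : nat) (A : formula).

Definition update (V : universe) (e : nat -> V) (i : nat) (x : V) : nat -> V :=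
  fun j => if Nat.eqb j i then x else e j.

Fixpoint sat (V : universe) (N : V) (A : formula) (e : nat -> V) : Prop :=
  match A with
  | FMem i j => e i ∈ e j
  | FEq i j => e i = e j
  | FNot A => ~ sat N A e
  | FAnd A B => sat N A e /\ sat N B e
  | FEx i A => exists x, x ∈ N /\ sat N A (update e i x)
  end.

(* The empty set has no valuations, so it has to be excluded explicitly. *)
Definition elementary (V : universe) (M N : V) : Prop :=
  (exists x, x ∈ M) /\ M ⊆ N /\
  forall (A : formula) (e : nat -> V),
    (forall i, e i ∈ M) -> (sat M A e <-> sat N A e).

Notation "M ≺ N" := (elementary M N) (at level 70, no associativity)
  : set_theory_scope.

(** * Guessing models *)

Definition guessing (V : universe) (M : V) : Prop :=
  forall X x : V, X ∈ M -> x ⊆ X ->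
    ((forall a, a ∈ M -> countable a -> a ∩ x ∈ M) <->
     (exists y, y ∈ M /\ y ∩ M = x ∩ M)).

(* Stationarity in P_ω2(H_θ). *)
Definition stationary (V : universe) (θ : V) (S : V -> Prop) : Prop :=
  (forall M, S M -> M ∈ P_ omega2 (H θ)) /\
  forall F : V -> V,
    (forall e, e ∈ P_ omega (H θ) -> F e ∈ P_ omega2 (H θ)) ->
    exists M, S M /\ M ≺ H θ /\ M ∩ omega2 ∈ omega2 /\
      (forall e, e ∈ P_ omega M -> F e ⊆ M).

Definition GMP (V : universe) : Prop :=
  forall θ : V, regular θ -> omega2 ⊆ θ ->
    stationary θ (fun M => M ≺ H θ /\ card_eq M omega1 /\ guessing M).

(** * Forcing notions *)

(* A forcing notion is the pair of a nonempty set of conditions and a preorder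
   on it; a largest condition is not required. *)
Definition conds (V : universe) (P : V) : V := the (fun A => exists L, P = opair A L).
Definition order (V : universe) (P : V) : V := the (fun L => exists A, P = opair A L).
Definition le (V : universe) (P p q : V) : Prop := opair p q ∈ order P.

Definition forcing_notion (V : universe) (P : V) : Prop :=
  P = opair (conds P) (order P) /\
  (exists p, p ∈ conds P) /\
  (forall w, w ∈ order P ->
     exists p q, p ∈ conds P /\ q ∈ conds P /\ w = opair p q) /\
  (forall p, p ∈ conds P -> le P p p) /\
  (forall p q r, le P p q -> le P q r -> le P p r).

Definition restriction (V : universe) (P p : V) : V :=
  opair (setof (fun q => le P q p))
        (setof (fun w => exists q r, w = opair q r /\
                           le P q p /\ le P r p /\ le P q r)).

(* Closure under restriction is what lets the forcing axiom for the class yield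
   filters through a prescribed condition.  Without it, FA holds trivially for
   every P that has an atom, for instance for the disjoint sum of a one-point
   order with Col(ω, ω1). *)
Definition restriction_closed (V : universe) (K : V -> Prop) : Prop :=
  forall P p, K P -> p ∈ conds P -> K (restriction P p).

Definition compatible (V : universe) (P p q : V) : Prop :=
  exists r, le P r p /\ le P r q.

Definition dense (V : universe) (P D : V) : Prop :=
  D ⊆ conds P /\ forall p, p ∈ conds P -> exists d, d ∈ D /\ le P d p.

Definition predense_below (V : universe) (P A p : V) : Prop :=
  forall q, le P q p -> exists a, a ∈ A /\ compatible P a q.

Definition filter (V : universe) (P G : V) : Prop :=
  G ⊆ conds P /\ (exists p, p ∈ G) /\
  (forall p q, p ∈ G -> le P p q -> q ∈ G) /\
  (forall p q, p ∈ G -> q ∈ G -> exists r, r ∈ G /\ le P r p /\ le P r q).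

Definition FA (V : universe) (K : V -> Prop) (κ : V) : Prop :=
  forall P, K P ->
  forall D : V, (forall d, d ∈ D -> dense P d) -> card_le D κ ->
  exists G, filter P G /\ forall d, d ∈ D -> exists p, p ∈ G /\ p ∈ d.

Definition generic_condition (V : universe) (M P q : V) : Prop :=
  q ∈ conds P /\
  forall D, D ∈ M -> dense P D -> predense_below P (M ∩ D) q.

(* P is a constant of the structure (H_θ, ∈, P), hence P ∈ M; for large θ,
   elementarity then puts conds P and its power set in M as well. *)
Definition proper_omega1 (V : universe) (P : V) : Prop :=
  for_large_regular (fun θ : V =>
    forall M, P ∈ M -> M ≺ H θ -> omega1 ⊆ M -> card_eq M omega1 ->
    forall p, p ∈ M -> p ∈ conds P ->
    exists q, le P q p /\ generic_condition M P q).

(** * Names and the forcing relation *)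

(* [Name x f a] stands for { (f i, p) : i ∈ x, p a condition, a i p }.  By
   replacement and separation every name in the universe has this form. *)
Inductive name (V : universe) : Type :=
| Name (x : V) (f : forall i : V, i ∈ x -> name V) (a : V -> V -> Prop).

Definition check (V : universe) : V -> name V :=
  Fix (@foundation V) (fun _ => name V)
    (fun x rec => Name (fun y (h : y ∈ x) => rec y h) (fun _ _ => True)).

(* A statement φ of the forcing language is identified with its forcing
   relation: [φ P p] reads "p forces φ over P".  All the connectives below yield
   statements that are forced by p as soon as they are forced densely below p. *)
Definition statement (V : universe) : Type := V -> V -> Prop.

Definition densely_below (V : universe) (P p : V) (Q : V -> Prop) : Prop :=
  forall q, le P q p -> exists r, le P r q /\ Q r.

Definition below_some (V : universe) (P p : V) (A : V -> Prop) : Prop :=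
  exists q, A q /\ le P p q.

(* p forces σ = τ iff, for every (π, s) in σ, every q ≤ p, s forces π ∈ τ, and
   symmetrically; "forces π ∈ τ" is as in [f_mem], written out. *)
Fixpoint f_eq (V : universe) (σ τ : name V) : statement V :=
  match σ, τ with
  | @Name _ x f a, @Name _ y g b => fun P p =>
      (forall i (hi : i ∈ x) q, le P q p -> below_some P q (a i) ->
         densely_below P q (fun r =>
           exists j (hj : j ∈ y), below_some P r (b j) /\ f_eq (f i hi) (g j hj) P r)) /\
      (forall j (hj : j ∈ y) q, le P q p -> below_some P q (b j) ->
         densely_below P q (fun r =>
           exists i (hi : i ∈ x), below_some P r (a i) /\ f_eq (f i hi) (g j hj) P r))
  end.

Definition f_mem (V : universe) (σ τ : name V) : statement V :=
  match τ with
  | @Name _ y g b => fun P p =>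
      densely_below P p (fun r =>
        exists j (hj : j ∈ y), below_some P r (b j) /\ f_eq σ (g j hj) P r)
  end.

Definition f_lift (V : universe) (Q : Prop) : statement V := fun _ _ => Q.

Definition f_not (V : universe) (φ : statement V) : statement V :=
  fun P p => forall q, le P q p -> ~ φ P q.

Definition f_and (V : universe) (φ ψ : statement V) : statement V :=
  fun P p => φ P p /\ ψ P p.

Definition f_or (V : universe) (φ ψ : statement V) : statement V :=
  fun P p => densely_below P p (fun q => φ P q \/ ψ P q).

Definition f_imp (V : universe) (φ ψ : statement V) : statement V :=
  fun P p => forall q, le P q p -> φ P q -> ψ P q.

Definition f_all (V : universe) (T : Type) (φ : T -> statement V) : statement V :=
  fun P p => forall t, φ t P p.

Definition f_ex (V : universe) (T : Type) (φ : T -> statement V) : statement V :=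
  fun P p => densely_below P p (fun q => exists t, φ t P q).

Declare Scope forcing_scope.
Delimit Scope forcing_scope with F.
Bind Scope forcing_scope with statement.

Notation "x ∈ y" := (f_mem x y) : forcing_scope.
Notation "x = y" := (f_eq x y) : forcing_scope.
Notation "A ∧ B" := (f_and A B) : forcing_scope.
Notation "A ∨ B" := (f_or A B) : forcing_scope.
Notation "A ⇒ B" := (f_imp A B)
  (at level 99, right associativity, B at level 200) : forcing_scope.
Notation "A ⇔ B" := (f_and (f_imp A B) (f_imp B A))
  (at level 95, no associativity) : forcing_scope.
Notation "⋀ x .. y , A" := (f_all (fun x => .. (f_all (fun y => A%F)) ..))
  (at level 200, x binder, y binder, right associativity) : forcing_scope.
Notation "⋁ x .. y , A" := (f_ex (fun x => .. (f_ex (fun y => A%F)) ..))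
  (at level 200, x binder, y binder, right associativity) : forcing_scope.

Definition f_sub (V : universe) (x y : name V) : statement V :=
  (⋀ z : name V, z ∈ x ⇒ z ∈ y)%F.

Notation "x ⊆ y" := (f_sub x y) : forcing_scope.

(* "φ holds in V[G] for every V-generic G ⊆ P". *)
Definition forced (V : universe) (P : V) (φ : statement V) : Prop :=
  forall p, p ∈ conds P -> φ P p.

Definition f_upair (V : universe) (u x y : name V) : statement V :=
  (⋀ z : name V, z ∈ u ⇔ (z = x ∨ z = y))%F.

Definition f_opair (V : universe) (w x y : name V) : statement V :=
  (⋁ u v : name V, f_upair u x x ∧ f_upair v x y ∧ f_upair w u v)%F.

Definition f_cap (V : universe) (b x y : name V) : statement V :=
  (⋀ z : name V, z ∈ b ⇔ (z ∈ x ∧ z ∈ y))%F.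

(* Some set f is an injective function with values in ω at the elements of x. *)
Definition f_countable (V : universe) (x : name V) : statement V :=
  (⋁ f : name V,
     (⋀ y : name V, y ∈ x ⇒
        ⋁ n w : name V, n ∈ check omega ∧ w ∈ f ∧ f_opair w y n) ∧
     (⋀ y n y' n' w w' : name V,
        (w ∈ f ∧ w' ∈ f ∧ f_opair w y n ∧ f_opair w' y' n') ⇒
        (y = y' ⇔ n = n')))%F.

(* [guessing], read in the generic extension. *)
Definition f_guessing (V : universe) (M : name V) : statement V :=
  (⋀ X x : name V, (X ∈ M ∧ x ⊆ X) ⇒
     ((⋀ a : name V, (a ∈ M ∧ f_countable a) ⇒
         ⋁ b : name V, b ∈ M ∧ f_cap b a x) ⇔
      (⋁ y : name V, y ∈ M ∧
         ⋁ b : name V, f_cap b y M ∧ f_cap b x M)))%F.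

Definition omega1_preserving (V : universe) (P : V) : Prop :=
  forced P (f_not (f_countable (check omega1))).

(* P-IGMP(ω2) presupposes that P preserves ω1, so this is part of it. *)
Definition IGMP (V : universe) (P : V) : Prop :=
  omega1_preserving P /\
  for_large_regular (fun θ : V =>
    stationary θ (fun M => M ∈ P_ omega2 (H θ) /\ card_eq M omega1 /\
                           guessing M /\ forced P (f_guessing (check M)))).

(* Quantifiers over V range over the (check names of) ground model sets, and
   countability of a is meant in V. *)
Definition omega1_approximation (V : universe) (P : V) : Prop :=
  forced P (⋀ x : name V,
    ((⋁ X : V, x ⊆ check X) ∧
     (⋀ a : V, f_lift (countable a) ⇒ ⋁ b : V, f_cap (check b) (check a) x)) ⇒
    ⋁ y : V, x = check y)%F.

(* Main.v *)
From Stdlib Require Import Classical ClassicalEpsilon FunctionalExtensionality.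
From Stdlib Require Import PeanoNat Lia.
Require Import Defs.

(* Let M be a guessing model with ω1 ⊆ M of size ω1, and let x be a name of a
   subset of some X ∈ M, all of whose countable approximations from M are forced
   into M.  If a condition forced that x is not guessed by M, then a filter
   meeting the ω1 dense sets "m ∩ x is decided" (m ∈ M countable) and "x ∩ M
   differs from y ∩ M" (y ∈ M) would interpret x by a ground model set which M
   fails to guess.  So M remains guessing.  If moreover x has all its countable
   approximations in V, choose M containing x and an (M, P)-generic q: genericity
   puts the approximations a ∩ x, for a ∈ M, into M, so below some t ≤ q the name
   x is guessed by some y ∈ M, and by genericity again x = y cannot fail densely.

   Elementarity of M enters only through properness: the sets that M has to
   contain are obtained by closing M under suitable operations, which is part of
   stationarity. *)

(** The forcing axiom handles ω1 dense sets at a time, and a model of size ω1 asks for exactly that: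
    one requirement for each m ∈ M. The resulting filter is not generic over V, so it evaluates no
    name correctly in general; it only has to produce a ground model set on which the guessing
    property of M in V can be tried. Both conclusions rest on this one argument ([guessed_below]),
    and they differ in how the countable approximations get into M: for IGMP this is an assumption
    on x in the extension, for the approximation property it is extracted from properness. Guessing
    in the extension speaks of sets that are countable there, so countability of ground model sets
    has to be absolute. This, like the preservation of ω1, again comes from the forcing axiom: a
    filter meeting ω1 dense sets turns a name of an injection into ω into a real injection. *)

Set Implicit Arguments.
Unset Strict Implicit.

(** * Comprehension, transitive closures, comparison of sizes and H θ *)

Section SetTheory.
Context {V : universe}.
Implicit Types (x y z w s t a b : V).

Lemma the_spec (C : V -> Prop) : (exists x, C x) -> C (the C).
Proof. apply epsilon_spec. Qed.

Lemma setof_spec (C : V -> Prop) :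
  (exists s, forall x, x ∈ s <-> C x) -> forall x, x ∈ setof C <-> C x.
Proof. intro Hs; exact (the_spec Hs). Qed.

Lemma setof_bounded (C : V -> Prop) b :
  (forall x, C x -> x ∈ b) -> forall x, x ∈ setof C <-> C x.
Proof.
intro Cb; apply setof_spec.
destruct (separation C b) as [s Hs]; exists s; intro x; rewrite Hs; firstorder.
Qed.

Lemma cap_spec x y z : z ∈ x ∩ y <-> z ∈ x /\ z ∈ y.
Proof. apply setof_bounded with x; tauto. Qed.

Lemma upair_spec x y z : z ∈ upair x y <-> z = x \/ z = y.
Proof. revert z; apply setof_spec, pairing. Qed.

Lemma powerset_spec x z : z ∈ powerset x <-> z ⊆ x.
Proof. revert z; apply setof_spec, power. Qed.

Definition bigcup x : V := setof (fun z => exists y, y ∈ x /\ z ∈ y).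

Lemma bigcup_spec x z : z ∈ bigcup x <-> exists y, y ∈ x /\ z ∈ y.
Proof. revert z; apply setof_spec, union. Qed.

Definition cup x y : V := bigcup (upair x y).

Lemma cup_spec x y z : z ∈ cup x y <-> z ∈ x \/ z ∈ y.
Proof.
unfold cup; rewrite bigcup_spec; split.
- intros [t [Ht Hz]]; apply upair_spec in Ht as [-> | ->]; auto.
- intros [Hz | Hz]; [exists x | exists y]; rewrite upair_spec; auto.
Qed.

Definition sep x (C : V -> Prop) : V := setof (fun z => z ∈ x /\ C z).

Lemma sep_spec x (C : V -> Prop) z : z ∈ sep x C <-> z ∈ x /\ C z.
Proof. apply setof_bounded with x; tauto. Qed.

Definition image (f : V -> V) x : V := setof (fun y => exists t, t ∈ x /\ y = f t).

Lemma image_spec (f : V -> V) x y : y ∈ image f x <-> exists t, t ∈ x /\ y = f t.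
Proof.
revert y; apply setof_spec; apply replacement.
intros; congruence.
Qed.

Definition empty : V := setof (fun _ => False).

Lemma in_empty z : ~ z ∈ empty.
Proof.
unfold empty; rewrite (@setof_bounded (fun _ => False) z); tauto.
Qed.

Definition succ x : V := cup x (upair x x).

Lemma succ_spec x z : z ∈ succ x <-> z ∈ x \/ z = x.
Proof. unfold succ; rewrite cup_spec, upair_spec; tauto. Qed.

Lemma sub_antisym x y : x ⊆ y -> y ⊆ x -> x = y.
Proof. intros; apply extensionality; firstorder. Qed.

Lemma mem_irrefl x : ~ x ∈ x.
Proof.
induction (foundation x) as [x _ IH]; intro Hx; exact (IH x Hx Hx).
Qed.

Lemma upair_inj x y y' : upair x y = upair x y' -> y = y'.
Proof.
intro E.
assert (Hy : y ∈ upair x y') by (rewrite <- E; apply upair_spec; auto).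
assert (Hy' : y' ∈ upair x y) by (rewrite E; apply upair_spec; auto).
apply upair_spec in Hy, Hy'; intuition congruence.
Qed.

Lemma upairC x y : upair x y = upair y x.
Proof. apply extensionality; intro z; rewrite !upair_spec; tauto. Qed.

Lemma opair_inj x y x' y' : opair x y = opair x' y' -> x = x' /\ y = y'.
Proof.
unfold opair; intro E.
assert (Ex : x = x').
{ assert (Hx : upair x x ∈ upair (upair x' x') (upair x' y')).
  { rewrite <- E; apply upair_spec; auto. }
  apply upair_spec in Hx.
  assert (Hx' : x' ∈ upair x x).
  { destruct Hx as [-> | ->]; apply upair_spec; auto. }
  apply upair_spec in Hx'; intuition congruence. }
subst x'; split; [reflexivity |].
now apply upair_inj in E; apply upair_inj in E.
Qed.

Lemma transitive_bigcup x : (forall y, y ∈ x -> transitive y) -> transitive (bigcup x).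
Proof.
intros Hx y Hy z Hz; apply bigcup_spec in Hy as [t [Ht Hy]].
apply bigcup_spec; exists t; split; [assumption | exact (Hx t Ht y Hy z Hz)].
Qed.

(** By ∈-induction: unite chosen transitive supersets of the members and adjoin x. No iteration
    along ω is involved, so [trcl] is available before the natural numbers. *)
Lemma transitive_superset x : exists t, transitive t /\ x ⊆ t.
Proof.
induction (foundation x) as [x _ IH].
set (T := fun y => the (fun t => transitive t /\ y ⊆ t)).
assert (HT : forall y, y ∈ x -> transitive (T y) /\ y ⊆ T y).
{ intros y Hy; apply the_spec; auto. }
exists (cup x (bigcup (image T x))); split.
- intros y Hy z Hz; apply cup_spec; right; apply cup_spec in Hy as [Hy | Hy].
  + apply bigcup_spec; exists (T y); split; [apply image_spec; eauto |].
    now apply HT.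
  + assert (Htr : transitive (bigcup (image T x))).
    { apply transitive_bigcup; intros t Ht; apply image_spec in Ht as [u [Hu ->]].
      now apply HT. }
    exact (Htr y Hy z Hz).
- intros z Hz; apply cup_spec; auto.
Qed.

Lemma trcl_spec x z : z ∈ trcl x <-> forall t, transitive t -> x ⊆ t -> z ∈ t.
Proof.
destruct (transitive_superset x) as [b [Hb Hxb]].
apply setof_bounded with b; auto.
Qed.

Lemma trcl_transitive x : transitive (trcl x).
Proof.
intros y Hy z Hz; rewrite trcl_spec in *; intros t Ht Hxt.
exact (Ht y (Hy t Ht Hxt) z Hz).
Qed.

Lemma sub_trcl x : x ⊆ trcl x.
Proof. intros z Hz; apply trcl_spec; auto. Qed.

Lemma trcl_min x t : transitive t -> x ⊆ t -> trcl x ⊆ t.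
Proof. intros Ht Hx z Hz; rewrite trcl_spec in Hz; auto. Qed.

Lemma card_le_sub x y : x ⊆ y -> card_le x y.
Proof. intro Hxy; exists (fun z => z); auto. Qed.

Lemma card_le_trans x y z : card_le x y -> card_le y z -> card_le x z.
Proof.
intros [f [fy finj]] [g [gz ginj]]; exists (fun t => g (f t)); split; auto.
Qed.

Lemma card_le_image (f : V -> V) x : card_le (image f x) x.
Proof.
exists (fun y => the (fun t => t ∈ x /\ y = f t)).
assert (Hf : forall y, y ∈ image f x ->
  the (fun t => t ∈ x /\ y = f t) ∈ x /\ y = f (the (fun t => t ∈ x /\ y = f t))).
{ intros y Hy; apply (the_spec (C := fun t => t ∈ x /\ y = f t)).
  now apply image_spec. }
split; [apply Hf |].
intros y y' Hy Hy' E; rewrite (proj2 (Hf y Hy)), (proj2 (Hf y' Hy')), E; reflexivity.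
Qed.

Lemma card_eq_le x y : card_eq x y -> card_le x y.
Proof. intros [f [H1 [H2 _]]]; now exists f. Qed.

(* The transitive set s = trcl x is coded by an isomorphic copy of (s, ∈) on a
   subset of κ, and s is recovered from the code by Mostowski collapse. *)
Lemma bounded_by_card κ : exists u, forall x, card_le (trcl x) κ -> x ∈ u.
Proof.
set (coded := fun E s => transitive s /\ exists f : V -> V,
  (forall z, z ∈ s -> f z ∈ κ) /\
  (forall z z', z ∈ s -> z' ∈ s -> f z = f z' -> z = z') /\
  (* The diagonal pairs record the domain of the code: with ∈ alone, the empty set and its singleton
     would share the empty code. *)
  forall w, w ∈ E <-> exists a b, a ∈ s /\ b ∈ s /\ (a ∈ b \/ a = b) /\
    w = opair (f a) (f b)).
assert (half : forall E s s', coded E s -> coded E s' -> s ⊆ s').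
{ intros E s s' [Hs [f [fκ [finj fE]]]] [Hs' [f' [fκ' [finj' fE']]]].
  assert (iso : forall a a', a ∈ s -> a' ∈ s' -> f a = f' a' -> a = a').
  { intro a; induction (foundation a) as [a _ IH]; intros a' Ha Ha' Eaa.
    apply extensionality; intro z; split; intro Hz.
    - assert (zs : z ∈ s) by exact (Hs a Ha z Hz).
      assert (Hp : opair (f z) (f a) ∈ E).
      { apply fE; exists z, a; auto. }
      apply fE' in Hp as [z' [c [Hz' [Hc [Hzc Ep]]]]].
      apply opair_inj in Ep as [E1 E2].
      assert (c = a') by (apply finj'; congruence); subst c.
      destruct Hzc as [Hzc | ->].
      + rewrite (IH z Hz z'); auto.
      + assert (z = a) by (apply finj; congruence); subst z.
        now apply mem_irrefl in Hz.
    - assert (zs : z ∈ s') by exact (Hs' a' Ha' z Hz).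
      assert (Hp : opair (f' z) (f' a') ∈ E).
      { apply fE'; exists z, a'; auto. }
      apply fE in Hp as [z' [c [Hz' [Hc [Hzc Ep]]]]].
      apply opair_inj in Ep as [E1 E2].
      assert (c = a) by (apply finj; congruence); subst c.
      destruct Hzc as [Hzc | ->].
      + rewrite <- (IH z' Hzc z); auto.
      + assert (z = a') by (apply finj'; congruence); subst z.
        now apply mem_irrefl in Hz. }
  intros a Ha.
  assert (Hp : opair (f a) (f a) ∈ E) by (apply fE; exists a, a; auto).
  apply fE' in Hp as [a' [c [Ha' [_ [_ Ep]]]]]; apply opair_inj in Ep as [E1 _].
  rewrite (iso a a'); auto. }
destruct (@replacement V coded (powerset (powerset (powerset κ)))) as [S HS].
{ intros E s s' _ Hs Hs'; apply sub_antisym; eauto. }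
exists (powerset (bigcup S)); intros x [f [fκ finj]].
apply powerset_spec; intros z Hz; apply bigcup_spec.
exists (trcl x); split; [| now apply sub_trcl].
set (p3 := powerset (powerset κ)).
set (C := fun w => exists a b, a ∈ trcl x /\ b ∈ trcl x /\ (a ∈ b \/ a = b) /\
    w = opair (f a) (f b)).
apply HS; exists (sep p3 C); split.
- apply powerset_spec; intros w Hw; now apply sep_spec in Hw.
- split; [apply trcl_transitive |]; exists f; split; [| split]; auto.
  intro w; rewrite sep_spec; split; [now intros [_ Hw] |]; intro Hw; split; [| exact Hw].
  destruct Hw as [a [b [Ha [Hb [_ ->]]]]].
  apply powerset_spec; intros u Hu; apply powerset_spec; intros v Hv.
  apply upair_spec in Hu as [-> | ->]; apply upair_spec in Hv as [-> | ->]; auto.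
Qed.

Lemma H_spec θ x : x ∈ H θ <-> card_lt (trcl x) θ.
Proof.
destruct (bounded_by_card θ) as [u Hu].
apply (@setof_bounded (fun x => card_lt (trcl x) θ) u); intros y [Hy _]; auto.
Qed.

Lemma transitive_trcl x : transitive x -> trcl x = x.
Proof.
intro Hx; apply sub_antisym; [| apply sub_trcl].
apply trcl_min; [assumption | now intros z Hz].
Qed.

Lemma hartogs_spec x a : a ∈ hartogs x <-> ordinal a /\ card_le a x.
Proof.
destruct (bounded_by_card x) as [u Hu].
apply (@setof_bounded (fun a => ordinal a /\ card_le a x) u).
intros b [[Hb _] Hbx]; apply Hu; now rewrite transitive_trcl.
Qed.

Lemma P_spec κ x y : y ∈ P_ κ x <-> y ⊆ x /\ card_lt y κ.
Proof.
apply setof_bounded with (powerset x); intros z [Hz _]; now apply powerset_spec.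
Qed.

Lemma card_lt_mono x y z : card_le x y -> card_lt y z -> card_lt x z.
Proof.
intros Hxy [Hyz Hzy]; split; [now apply card_le_trans with y |].
intro Hzx; apply Hzy; now apply card_le_trans with x.
Qed.

Lemma H_sub θ x y : trcl x ⊆ trcl y -> y ∈ H θ -> x ∈ H θ.
Proof. rewrite !H_spec; intros; eapply card_lt_mono; eauto using card_le_sub. Qed.

Lemma H_transitive θ x y : y ∈ H θ -> x ∈ y -> x ∈ H θ.
Proof.
intros Hy Hx; apply H_sub with y; [| assumption].
apply trcl_min; [apply trcl_transitive |].
apply trcl_transitive; now apply sub_trcl.
Qed.

(** * Ordinals *)

Lemma ordinal_mem a b : ordinal a -> b ∈ a -> ordinal b.
Proof.
intros [Ha Ha'] Hb; split; auto.
intros c Hc; apply Ha'; exact (Ha b Hb c Hc).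
Qed.

Lemma ordinal_succ a : ordinal a -> ordinal (succ a).
Proof.
intros [Ha Ha']; split.
- intros b Hb c Hc; apply succ_spec; left.
  apply succ_spec in Hb as [Hb | ->]; [exact (Ha b Hb c Hc) | assumption].
- intros b Hb; apply succ_spec in Hb as [Hb | ->]; auto.
Qed.

Lemma ordinal_bigcup x : (forall a, a ∈ x -> ordinal a) -> ordinal (bigcup x).
Proof.
intro Hx; split.
- apply transitive_bigcup; intros a Ha; now apply Hx.
- intros b Hb; apply bigcup_spec in Hb as [a [Ha Hb]].
  now apply (Hx a Ha).
Qed.

Lemma ordinal_trichotomy a b : ordinal a -> ordinal b -> a ∈ b \/ a = b \/ b ∈ a.
Proof.
revert b; induction (foundation a) as [a _ IHa]; intro b.
induction (foundation b) as [b _ IHb]; intros Ha Hb.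
destruct (classic (a ∈ b)) as [| nab]; [auto |].
destruct (classic (b ∈ a)) as [| nba]; [auto |].
right; left; apply sub_antisym.
- intros x Hx; destruct (IHa x Hx b) as [| [-> | Hbx]]; auto; try contradiction.
  + exact (ordinal_mem Ha Hx).
  + contradict nba; exact (proj1 Ha x Hx b Hbx).
- intros x Hx; destruct (IHb x Hx) as [Hax | [-> | Hbx]]; auto; try contradiction.
  + exact (ordinal_mem Hb Hx).
  + contradict nab; exact (proj1 Hb x Hx a Hax).
Qed.

Lemma ordinal_sub_succ a b : ordinal a -> ordinal b -> a ⊆ b -> a ∈ succ b.
Proof.
intros Ha Hb Hab; apply succ_spec.
destruct (ordinal_trichotomy Ha Hb) as [| [|Hba]]; auto.
destruct (mem_irrefl (Hab b Hba)).
Qed.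

Lemma ordinal_hartogs x : ordinal (hartogs x).
Proof.
split.
- intros a Ha b Hb; rewrite hartogs_spec in *; destruct Ha as [Ha Hax].
  split; [exact (ordinal_mem Ha Hb) |].
  apply card_le_trans with a; [exact (card_le_sub (proj1 Ha b Hb)) | assumption].
- intros a Ha; now apply hartogs_spec in Ha as [[Ha _] _].
Qed.

(** Burali-Forti: otherwise the ordinal [hartogs x] would be a member of itself. *)
Lemma hartogs_not_le x : ~ card_le (hartogs x) x.
Proof.
intro Hx; apply (@mem_irrefl (hartogs x)), hartogs_spec.
split; [apply ordinal_hartogs | assumption].
Qed.

(* Enumerate a along o by recursion: either the enumeration never stops, or it
   exhausts a at some β ∈ o. *)
Lemma ordinal_le_or_exhausts o a :
  ordinal o -> card_le o a \/ exists β, β ∈ o /\ card_le a β.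
Proof.
intro Ho.
set (step := fun (α : V) (g : forall β : V, β ∈ α -> V) =>
  the (fun z => z ∈ a /\ forall β (h : β ∈ α), z <> g β h)).
set (g := Fix (@foundation V) (fun _ => V : Type) step).
assert (gE : forall α, g α = the (fun z => z ∈ a /\ forall β, β ∈ α -> z <> g β)).
{ intro α; unfold g at 1; rewrite Fix_eq; [reflexivity |].
  intros x f f' Hf; f_equal; apply functional_extensionality_dep; intro y.
  apply functional_extensionality_dep; auto. }
destruct (classic (exists β, β ∈ o /\ forall z, z ∈ a -> exists γ, γ ∈ β /\ z = g γ))
  as [[β [Hβ Hex]] | Hne].
- right; exists β; split; [assumption |].
  exists (fun z => the (fun γ => γ ∈ β /\ z = g γ)); split.
  + intros z Hz; now apply (the_spec (Hex z Hz)).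
  + intros z z' Hz Hz' E; rewrite (proj2 (the_spec (Hex z Hz))).
    rewrite E; symmetry; apply (the_spec (Hex z' Hz')).
- left; exists g.
  assert (gP : forall α, α ∈ o -> g α ∈ a /\ forall β, β ∈ α -> g α <> g β).
  { intros α Hα; rewrite gE; apply the_spec.
    apply NNPP; intro Hn; apply Hne; exists α; split; [assumption |].
    intros z Hz; apply NNPP; intro Hn'; apply Hn; exists z; split; [assumption |].
    intros β Hβ E; apply Hn'; eauto. }
  split; [intros α Hα; now apply gP |].
  intros α α' Hα Hα' E.
  destruct (@ordinal_trichotomy α α') as [Hm | [| Hm]]; auto;
    try (eapply ordinal_mem; eauto; fail).
  + symmetry in E; now apply gP in E.
  + now apply gP in E.
Qed.

Lemma card_lt_hartogs x y : card_le y x -> card_lt y (hartogs x).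
Proof.
intro Hyx.
assert (Hn : ~ card_le (hartogs x) y).
{ intro Hxy; apply (@hartogs_not_le x); now apply card_le_trans with y. }
split; [| assumption].
destruct (@ordinal_le_or_exhausts (hartogs x) y (ordinal_hartogs x)) as [| [β [Hβ Hle]]].
- contradiction.
- apply card_le_trans with β; [assumption |].
  apply card_le_sub; now apply ordinal_hartogs.
Qed.

Lemma uncountable_spec a : ~ countable a -> card_le omega1 a.
Proof.
intro Ha; destruct (@ordinal_le_or_exhausts omega1 a (ordinal_hartogs omega))
  as [| [β [Hβ Hle]]]; [assumption |].
destruct Ha; apply card_le_trans with β; [assumption |].
now apply hartogs_spec in Hβ.
Qed.

(** * Natural numbers *)

Lemma inductive_succ x y : inductive_set x -> y ∈ x -> succ y ∈ x.
Proof.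
intros [_ Hx] Hy; destruct (Hx y Hy) as [s [Hs Es]].
replace (succ y) with s; [assumption |].
apply extensionality; intro z; now rewrite Es, succ_spec.
Qed.

Lemma inductive_empty x : inductive_set x -> empty ∈ x.
Proof.
intros [[e [He Ee]] _]; replace empty with e; [assumption |].
apply extensionality; intro z; split; intro Hz; [now apply Ee in Hz | now apply in_empty in Hz].
Qed.

Fixpoint num (n : nat) : V :=
  match n with O => empty | S n => succ (num n) end.

Lemma omega_spec x : x ∈ omega <-> exists n, x = num n.
Proof.
destruct (infinity V) as [u Hu].
assert (Hom : forall z, z ∈ omega <-> forall t, inductive_set t -> z ∈ t).
{ apply setof_bounded with u; auto. }
split.
- intro Hx; set (N := sep u (fun z => exists n, z = num n)).
  assert (HN : inductive_set N).
  { split.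
    - exists empty; split; [| apply in_empty].
      apply sep_spec; split; [now apply inductive_empty | now exists 0].
    - intros y Hy; apply sep_spec in Hy as [Hy [n ->]].
      exists (succ (num n)); split; [| apply succ_spec].
      apply sep_spec; split; [now apply inductive_succ | now exists (S n)]. }
  apply Hom with (t := N) in Hx; [| assumption]; now apply sep_spec in Hx.
- intros [n ->]; apply Hom; intros t Ht; induction n.
  + now apply inductive_empty.
  + now apply inductive_succ.
Qed.

Lemma num_omega n : num n ∈ omega.
Proof. apply omega_spec; eauto. Qed.

Lemma num_ordinal n : ordinal (num n).
Proof.
induction n; [| now apply ordinal_succ].
split; intros y Hy; now apply in_empty in Hy.
Qed.

Lemma num_mem m n : m < n -> num m ∈ num n.
Proof.
induction 1; apply succ_spec; auto.
Qed.

Lemma num_inj m n : num m = num n -> m = n.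
Proof.
intro E; destruct (Nat.lt_trichotomy m n) as [Hm | [| Hm]]; auto;
  apply num_mem in Hm; rewrite E in Hm; now apply mem_irrefl in Hm.
Qed.

Lemma num_sub_omega n : num n ⊆ omega.
Proof.
induction n; intros z Hz; [now apply in_empty in Hz |].
apply succ_spec in Hz as [Hz | ->]; [auto | apply num_omega].
Qed.

Lemma omega_ordinal : ordinal (@omega V).
Proof.
split.
- intros y Hy; apply omega_spec in Hy as [n ->]; apply num_sub_omega.
- intros y Hy; apply omega_spec in Hy as [n ->]; apply num_ordinal.
Qed.

Definition nat_of x : nat := epsilon (inhabits 0) (fun n => x = num n).

Lemma nat_of_num n : nat_of (num n) = n.
Proof.
apply num_inj; symmetry; unfold nat_of.
apply (epsilon_spec (inhabits 0) (fun m => num n = num m)); now exists n.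
Qed.

(** The index type [nat] is not a set of the universe, so the family is transported to [omega] along
    [nat_of] before replacement can collect it. *)
Definition seq_union (A : nat -> V) : V :=
  bigcup (image (fun t => A (nat_of t)) omega).

Lemma seq_union_spec (A : nat -> V) z : z ∈ seq_union A <-> exists n, z ∈ A n.
Proof.
unfold seq_union; rewrite bigcup_spec; split.
- intros [y [Hy Hz]]; apply image_spec in Hy as [t [_ ->]]; eauto.
- intros [n Hz]; exists (A n); split; [| assumption].
  apply image_spec; exists (num n); rewrite nat_of_num; split; [apply num_omega | reflexivity].
Qed.

(* Hilbert's hotel. *)
Lemma card_le_adjoin z w b :
  card_le omega w -> card_le z w -> card_le (cup z (upair b b)) w.
Proof.
intros [h [hw hinj]] [f [fw finj]].
set (k := fun n => h (num n)).
assert (kinj : forall m n, k m = k n -> m = n).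
{ intros m n E; apply num_inj, hinj; auto using num_omega. }
set (hotel := fun y => match excluded_middle_informative (exists n, y = k n) with
  | left e => k (S (proj1_sig (constructive_indefinite_description _ e)))
  | right _ => y end).
assert (hotel_k : forall n, hotel (k n) = k (S n)).
{ intro n; unfold hotel; destruct excluded_middle_informative as [e | e].
  - destruct constructive_indefinite_description as [m Em]; simpl.
    now apply kinj in Em as ->.
  - now destruct e; exists n. }
assert (hotel_other : forall y, ~ (exists n, y = k n) -> hotel y = y).
{ intros y Hy; unfold hotel; now destruct excluded_middle_informative. }
assert (hotel_w : forall y, y ∈ w -> hotel y ∈ w /\ hotel y <> k 0).
{ intros y Hy; destruct (classic (exists n, y = k n)) as [[n ->] | Hn].
  - rewrite hotel_k; split; [apply hw, num_omega |].
    intro E; now apply kinj in E.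
  - rewrite hotel_other by assumption; split; eauto. }
assert (hotel_inj : forall y y', hotel y = hotel y' -> y = y').
{ intros y y'; destruct (classic (exists n, y = k n)) as [[n ->] | Hn];
    destruct (classic (exists n, y' = k n)) as [[n' ->] | Hn'];
    rewrite ?hotel_k, ?hotel_other by assumption; intro E.
  - apply kinj in E; congruence.
  - destruct Hn'; eauto.
  - destruct Hn; eauto.
  - assumption. }
exists (fun y => if excluded_middle_informative (y ∈ z) then hotel (f y) else k 0).
split.
- intros y Hy; destruct excluded_middle_informative as [Hz | Hz].
  + now apply hotel_w, fw.
  + apply hw, num_omega.
- intros y y' Hy Hy'.
  rewrite cup_spec, upair_spec in Hy, Hy'.
  destruct (excluded_middle_informative (y ∈ z)) as [Hz | Hz];
    destruct (excluded_middle_informative (y' ∈ z)) as [Hz' | Hz']; intro E.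
  + apply finj; auto.
  + now apply hotel_w in E; [| apply fw].
  + symmetry in E; now apply hotel_w in E; [| apply fw].
  + intuition congruence.
Qed.

Lemma omega_le_omega1 : card_le (@omega V) omega1.
Proof. apply card_lt_hartogs; apply card_le_sub; now intros z Hz. Qed.

Lemma card_lt_hartogs_adjoin κ z b :
  card_le omega κ -> card_lt z (hartogs κ) -> card_lt (cup z (upair b b)) (hartogs κ).
Proof.
intros Hκ [_ Hz].
destruct (ordinal_le_or_exhausts z (ordinal_hartogs κ)) as [| [β [Hβ Hzβ]]];
  [contradiction |].
apply hartogs_spec in Hβ as [_ Hβ].
apply card_lt_hartogs, card_le_adjoin; [assumption |].
now apply card_le_trans with β.
Qed.

(** * Large regular cardinals *)

Lemma pairing_closure x :
  exists u, x ⊆ u /\ transitive u /\ forall a b, a ∈ u -> b ∈ u -> upair a b ∈ u.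
Proof.
set (next := fun y => cup y (bigcup (image (fun a => image (upair a) y) y))).
assert (nextP : forall y z, z ∈ next y <->
  z ∈ y \/ exists a b, a ∈ y /\ b ∈ y /\ z = upair a b).
{ intros y z; unfold next; rewrite cup_spec, bigcup_spec; split.
  - intros [| [t [Ht Hz]]]; [auto | right].
    apply image_spec in Ht as [a [Ha ->]]; apply image_spec in Hz as [b [Hb ->]]; eauto 6.
  - intros [| [a [b [Ha [Hb ->]]]]]; [auto | right].
    exists (image (upair a) y); split; apply image_spec; eauto. }
set (A := fix A n := match n with O => trcl x | S n => next (A n) end).
assert (Amono : forall m n, m <= n -> A m ⊆ A n).
{ induction 1; intros z Hz; [assumption |]; apply nextP; auto. }
exists (seq_union A); split; [| split].
- intros z Hz; apply seq_union_spec; exists 0; now apply sub_trcl.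
- intros y Hy z Hz; apply seq_union_spec in Hy as [n Hy]; apply seq_union_spec.
  revert y z Hy Hz; induction n; intros y z Hy Hz.
  + exists 0; exact (trcl_transitive Hy Hz).
  + apply nextP in Hy as [Hy | [a [b [Ha [Hb ->]]]]]; [eauto |].
    exists n; apply upair_spec in Hz as [-> | ->]; assumption.
- intros a b Ha Hb; apply seq_union_spec in Ha as [m Ha], Hb as [n Hb].
  apply seq_union_spec; exists (S (m + n)); apply nextP; right; exists a, b.
  split; [| split]; [| | reflexivity].
  + apply Amono with m; [lia | assumption].
  + apply Amono with n; [lia | assumption].
Qed.

(** Regularity of a successor cardinal needs an injection of u × u into u. Closure under pairs makes
    [opair] itself such an injection, which avoids cardinal arithmetic: an element z of the union of
    x is coded by the code of some a ∈ x containing z, paired with the code of z in a. *)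
Lemma hartogs_regular u :
  omega ⊆ u -> (forall a b, a ∈ u -> b ∈ u -> upair a b ∈ u) -> regular (hartogs u).
Proof.
intros Hω Hpair.
assert (Hp : forall a b, a ∈ u -> b ∈ u -> opair a b ∈ u).
{ intros; apply Hpair; apply Hpair; assumption. }
split; [| split].
- split; [apply ordinal_hartogs |].
  intros a Ha Hle; apply hartogs_spec in Ha as [_ Ha].
  apply (@hartogs_not_le u); now apply card_le_trans with a.
- intros n Hn; apply hartogs_spec; split.
  + exact (ordinal_mem omega_ordinal Hn).
  + apply card_le_sub; intros z Hz; apply Hω.
    exact (proj1 omega_ordinal n Hn z Hz).
- intros x Hx [_ Hlt].
  assert (Hxu : card_le x u).
  { destruct (ordinal_le_or_exhausts x (ordinal_hartogs u)) as [| [β [Hβ Hxβ]]];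
      [contradiction |].
    apply hartogs_spec in Hβ as [_ Hβ]; now apply card_le_trans with β. }
  destruct Hxu as [f [fu finj]].
  set (g := fun a => epsilon (inhabits (fun z => z)) (fun g : V -> V =>
    (forall z, z ∈ a -> g z ∈ u) /\
    (forall z z', z ∈ a -> z' ∈ a -> g z = g z' -> z = z'))).
  assert (gP : forall a, a ∈ x -> (forall z, z ∈ a -> g a z ∈ u) /\
    (forall z z', z ∈ a -> z' ∈ a -> g a z = g a z' -> z = z')).
  { intros a Ha; apply Hx, hartogs_spec in Ha as [_ Ha].
    now apply epsilon_spec. }
  assert (Hord : forall a, a ∈ x -> ordinal a).
  { intros a Ha; now apply Hx, hartogs_spec in Ha. }
  assert (Hs : ordinal (bigcup x)) by now apply ordinal_bigcup.
  assert (Hcard : card_le (bigcup x) u).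
  { set (c := fun z => the (fun a => a ∈ x /\ z ∈ a)).
    assert (cP : forall z, z ∈ bigcup x -> c z ∈ x /\ z ∈ c z).
    { intros z Hz; apply (the_spec (C := fun a => a ∈ x /\ z ∈ a)).
      now apply bigcup_spec. }
    exists (fun z => opair (f (c z)) (g (c z) z)); split.
    - intros z Hz; destruct (cP z Hz); apply Hp; [auto | now apply gP].
    - intros z z' Hz Hz' E; apply opair_inj in E as [E1 E2].
      destruct (cP z Hz), (cP z' Hz'); apply finj in E1; [| assumption | assumption].
      apply (gP (c z)); [assumption | assumption | now rewrite E1 | now rewrite E2, E1]. }
  (* The bound has to be strict, and x may have a largest element, hence the successor. *)
  exists (succ (bigcup x)); split.
  + apply hartogs_spec; split; [now apply ordinal_succ |].
    apply card_le_adjoin; [now apply card_le_sub | assumption].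
  + intros a Ha; apply ordinal_sub_succ; auto.
    intros z Hz; apply bigcup_spec; eauto.
Qed.

End SetTheory.

(* What FA says about the restrictions of P, without mentioning them. *)
Definition meets_dense (V : universe) (P : V) : Prop :=
  forall p, p ∈ conds P -> forall (I : V) (D : V -> V -> Prop), card_le I omega1 ->
  (forall i q, i ∈ I -> le P q p -> exists r, le P r q /\ D i r) ->
  exists G : V -> Prop, (forall q, G q -> le P q p) /\
    (forall q r, G q -> G r -> exists s, le P s q /\ le P s r) /\
    (forall i, i ∈ I -> exists q, G q /\ D i q).


(** * The forcing relation *)

Section Forcing.
Context {V : universe} {P : V} (P_forcing : forcing_notion P).
Implicit Types (p q r s t x y z a b : V) (σ τ ρ : name V).

Lemma P_opair : P = opair (conds P) (order P).
Proof. apply P_forcing. Qed.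

Lemma le_refl p : p ∈ conds P -> le P p p.
Proof. apply P_forcing. Qed.

Lemma le_trans p q r : le P p q -> le P q r -> le P p r.
Proof. apply P_forcing. Qed.

Lemma le_conds p q : le P p q -> p ∈ conds P /\ q ∈ conds P.
Proof.
intro Hpq; destruct P_forcing as [_ [_ [Ho _]]].
destruct (Ho _ Hpq) as [p' [q' [Hp [Hq E]]]].
apply opair_inj in E as [-> ->]; auto.
Qed.

Lemma le_refl_l p q : le P p q -> le P p p.
Proof. intro Hpq; now apply le_refl, (le_conds Hpq). Qed.

Hint Resolve le_trans le_refl le_refl_l : core.

Definition monotone (φ : statement V) : Prop :=
  forall p q, le P q p -> φ P p -> φ P q.

Definition local (φ : statement V) : Prop :=
  forall p, p ∈ conds P -> densely_below P p (φ P) -> φ P p.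

Lemma densely_mono p q (Q : V -> Prop) :
  le P q p -> densely_below P p Q -> densely_below P q Q.
Proof. intros Hqp HQ r Hr; eauto. Qed.

Lemma densely_imp p (Q Q' : V -> Prop) :
  densely_below P p Q -> (forall q, le P q p -> Q q -> Q' q) -> densely_below P p Q'.
Proof. intros HQ HQQ q Hq; destruct (HQ q Hq) as [r [Hr H]]; eauto. Qed.

Lemma densely_bind p (Q Q' : V -> Prop) :
  densely_below P p Q -> (forall q, le P q p -> Q q -> densely_below P q Q') ->
  densely_below P p Q'.
Proof.
intros HQ HQQ q Hq; destruct (HQ q Hq) as [r [Hr H]].
destruct (HQQ r) with (q := r) as [r' [Hr' H']]; eauto.
Qed.

Lemma densely_here p (Q : V -> Prop) :
  p ∈ conds P -> densely_below P p Q -> exists q, le P q p /\ Q q.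
Proof. intros Hp HQ; apply HQ; auto. Qed.

Lemma below_some_mono p q (A : V -> Prop) : le P q p -> below_some P p A -> below_some P q A.
Proof. intros Hqp [r [Hr Hpr]]; exists r; eauto. Qed.

Lemma f_eq_mono σ τ : monotone (f_eq σ τ).
Proof. intros p q Hqp; destruct σ, τ; simpl; intros [H1 H2].
split; intros i hi r Hr Hi; [apply (H1 i hi r) | apply (H2 i hi r)]; eauto.
Qed.

Lemma f_mem_mono σ τ : monotone (f_mem σ τ).
Proof. intros p q Hqp; destruct τ; simpl; apply densely_mono; assumption. Qed.

Lemma f_eq_local σ τ : local (f_eq σ τ).
Proof.
intros p Hp; destruct σ as [x f a], τ as [y g b]; intro HD.
split; intros i hi q Hq Hi; eapply densely_bind; try (eapply densely_mono; eassumption);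
  intros r Hr [H1 H2]; simpl in *; [apply H1 | apply H2];
  eauto using below_some_mono.
Qed.

Lemma f_mem_local σ τ : local (f_mem σ τ).
Proof.
intros p Hp HD; destruct τ as [y g b]; simpl in *.
eapply densely_bind; [exact HD | auto].
Qed.

Lemma f_eq_refl σ p : p ∈ conds P -> f_eq σ σ P p.
Proof.
revert p; induction σ as [x f IH a]; intros p Hp; simpl.
split; intros i hi q Hq Hi r Hr; exists r; split; eauto; exists i, hi;
  (split; [eauto using below_some_mono | apply IH; now apply (le_conds Hr)]).
Qed.

Lemma f_eq_sym σ τ p : f_eq σ τ P p -> f_eq τ σ P p.
Proof.
revert τ p; induction σ as [x f IH a]; intros [y g b] p; simpl; intros [H1 H2].
split; intros i hi q Hq Hi; [eapply densely_imp; [apply (H2 i hi q Hq Hi) |]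
  | eapply densely_imp; [apply (H1 i hi q Hq Hi) |]];
  intros r Hr [j [hj [Hj E]]]; exists j, hj; auto.
Qed.

Lemma f_eq_trans σ τ ρ p : f_eq σ τ P p -> f_eq τ ρ P p -> f_eq σ ρ P p.
Proof.
revert τ ρ p; induction σ as [x f IH a]; intros [y g b] [z h c] p; simpl.
intros [H1 H2] [H3 H4]; split.
- intros i hi q Hq Hi; apply (densely_bind (H1 i hi q Hq Hi)).
  intros r Hr [j [hj [Hj E]]].
  eapply densely_imp; [apply (H3 j hj r); eauto |].
  intros r' Hr' [k [hk [Hk E']]]; exists k, hk; split; [assumption |].
  eapply IH; [eapply f_eq_mono; eassumption | assumption].
- intros k hk q Hq Hk; apply (densely_bind (H4 k hk q Hq Hk)).
  intros r Hr [j [hj [Hj E]]].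
  eapply densely_imp; [apply (H2 j hj r); eauto |].
  intros r' Hr' [i [hi [Hi E']]]; exists i, hi; split; [assumption |].
  eapply IH; [eassumption | eapply f_eq_mono; eassumption].
Qed.

Lemma f_mem_eq_l σ σ' τ p : f_eq σ σ' P p -> f_mem σ τ P p -> f_mem σ' τ P p.
Proof.
destruct τ as [y g b]; simpl; intros E HD.
eapply densely_imp; [exact HD |]; intros q Hq [j [hj [Hj E']]].
exists j, hj; split; [assumption |].
eapply f_eq_trans; [apply f_eq_sym; eapply f_eq_mono; eassumption | assumption].
Qed.

Lemma f_mem_eq_r σ τ τ' p : f_eq τ τ' P p -> f_mem σ τ P p -> f_mem σ τ' P p.
Proof.
destruct τ as [y g b], τ' as [z h c]; simpl; intros [H1 H2] HD.
apply (densely_bind HD); intros q Hq [j [hj [Hj E]]].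
eapply densely_imp; [apply (H1 j hj q); auto |].
intros r Hr [k [hk [Hk E']]]; exists k, hk; split; [assumption |].
eapply f_eq_trans; [eapply f_eq_mono; eassumption | assumption].
Qed.

Lemma f_mem_self x (f : forall i, i ∈ x -> name V) (a : V -> V -> Prop) i (hi : i ∈ x) p :
  p ∈ conds P -> below_some P p (a i) -> f_mem (f i hi) (Name f a) P p.
Proof.
intros Hp Hi q Hq; exists q; split; [eauto |]; exists i, hi.
split; [eauto using below_some_mono | apply f_eq_refl; now apply (le_conds Hq)].
Qed.

Lemma f_eq_ext σ τ p : p ∈ conds P ->
  (forall ρ q, le P q p -> f_mem ρ σ P q -> f_mem ρ τ P q) ->
  (forall ρ q, le P q p -> f_mem ρ τ P q -> f_mem ρ σ P q) -> f_eq σ τ P p.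
Proof.
intros Hp H1 H2; destruct σ as [x f a], τ as [y g b]; split.
- intros i hi q Hq Hi; apply (H1 (f i hi) q Hq), f_mem_self; [| assumption].
  now apply (le_conds Hq).
- intros j hj q Hq Hj.
  assert (Hm : f_mem (g j hj) (Name f a) P q).
  { apply (H2 _ q Hq), f_mem_self; [now apply (le_conds Hq) | assumption]. }
  eapply densely_imp; [exact Hm |]; intros r Hr [i [hi [Hi E]]].
  exists i, hi; split; [assumption | now apply f_eq_sym].
Qed.

(** * Check names *)

Lemma check_unfold x : check x = Name (fun y (_ : y ∈ x) => check y) (fun _ _ => True).
Proof.
unfold check at 1; rewrite Fix_eq; [reflexivity |].
intros y f g Hfg; f_equal.
apply functional_extensionality_dep; intro z.
apply functional_extensionality_dep; intro hz; apply Hfg.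
Qed.

Lemma f_mem_check σ y p :
  f_mem σ (check y) P p <->
  densely_below P p (fun q => exists j, j ∈ y /\ f_eq σ (check j) P q).
Proof.
rewrite check_unfold; simpl; split; intro HD; apply (densely_imp HD).
- intros q Hq [j [hj [_ E]]]; eauto.
- intros q Hq [j [hj E]]; exists j, hj; split; [exists q; eauto | assumption].
Qed.

Lemma check_mem x y p : p ∈ conds P -> x ∈ y -> f_mem (check x) (check y) P p.
Proof.
intros Hp Hxy; apply f_mem_check; intros q Hq; exists q; split; [eauto |].
exists x; split; [assumption | apply f_eq_refl; now apply (le_conds Hq)].
Qed.

Lemma check_eq_inv x y p : p ∈ conds P -> f_eq (check x) (check y) P p -> x = y.
Proof.
revert y p; induction (foundation x) as [x _ IH]; intros y p Hp E.
apply extensionality; intro z; split; intro Hz.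
- assert (Hm : f_mem (check z) (check y) P p).
  { eapply f_mem_eq_r; [exact E | now apply check_mem]. }
  apply f_mem_check, densely_here in Hm as [q [Hq [j [Hj E']]]]; [| assumption].
  apply IH in E'; [congruence | assumption | now apply (le_conds Hq)].
- assert (Hm : f_mem (check z) (check x) P p).
  { eapply f_mem_eq_r; [apply f_eq_sym; exact E | now apply check_mem]. }
  apply f_mem_check, densely_here in Hm as [q [Hq [j [Hj E']]]]; [| assumption].
  apply f_eq_sym, IH in E'; [congruence | assumption | now apply (le_conds Hq)].
Qed.

Lemma check_mem_inv x y p : p ∈ conds P -> f_mem (check x) (check y) P p -> x ∈ y.
Proof.
intros Hp Hm; apply f_mem_check, densely_here in Hm as [q [Hq [j [Hj E]]]]; [| assumption].
apply check_eq_inv in E; [congruence | now apply (le_conds Hq)].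
Qed.

(** * Pairs and countability in the extension *)

Lemma f_upair_mono σ τ ρ : monotone (f_upair σ τ ρ).
Proof.
intros p q Hqp H z; destruct (H z) as [H1 H2].
split; intros r Hr Hz; [apply H1 | apply H2]; eauto.
Qed.

Lemma f_opair_mono σ τ ρ : monotone (f_opair σ τ ρ).
Proof. intros p q Hqp; apply densely_mono; assumption. Qed.

Lemma f_or_imp (φ ψ φ' ψ' : statement V) p :
  (forall q, le P q p -> φ P q -> φ' P q) -> (forall q, le P q p -> ψ P q -> ψ' P q) ->
  f_or φ ψ P p -> f_or φ' ψ' P p.
Proof.
intros H1 H2 HD; apply (densely_imp HD); intros q Hq [H | H]; auto.
Qed.

Lemma f_upair_eq σ σ' τ τ' ρ ρ' p :
  f_eq σ σ' P p -> f_eq τ τ' P p -> f_eq ρ ρ' P p ->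
  f_upair σ τ ρ P p -> f_upair σ' τ' ρ' P p.
Proof.
intros Eσ Eτ Eρ H z; destruct (H z) as [H1 H2]; split; intros q Hq Hz.
- assert (Hz' : f_mem z σ P q).
  { eapply f_mem_eq_r; [apply f_eq_sym; eapply f_eq_mono; eassumption | assumption]. }
  eapply f_or_imp; [| | apply (H1 q Hq Hz')]; intros r Hr E;
    (eapply f_eq_trans; [exact E | eapply f_eq_mono; [| eassumption]; eauto]).
- eapply f_mem_eq_r; [eapply f_eq_mono; eassumption |].
  apply (H2 q Hq); eapply f_or_imp; [| | apply Hz]; intros r Hr E;
    (eapply f_eq_trans; [exact E | apply f_eq_sym; eapply f_eq_mono; [| eassumption]; eauto]).
Qed.

(** Each existential quantifier of the forcing language brings its own density; the two are merged
    so that u and v are available at a single condition. *)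
Lemma f_opair_spec σ τ ρ p : f_opair σ τ ρ P p <->
  densely_below P p (fun q => exists u v,
    f_upair u τ τ P q /\ f_upair v τ ρ P q /\ f_upair σ u v P q).
Proof.
split; intro HD.
- apply (densely_bind HD); intros q Hq [u Hu].
  apply (densely_imp Hu); intros r Hr [v [H1 [H2 H3]]]; eauto.
- apply (densely_imp HD); intros q Hq [u [v [H1 [H2 H3]]]].
  exists u; intros r Hr; exists r; split; [eauto |]; exists v.
  split; [| split]; eapply f_upair_mono; eassumption.
Qed.

Lemma f_opair_eq σ τ τ' ρ ρ' p :
  f_eq τ τ' P p -> f_eq ρ ρ' P p -> f_opair σ τ ρ P p -> f_opair σ τ' ρ' P p.
Proof.
rewrite !f_opair_spec; intros Eτ Eρ HD.
apply (densely_imp HD); intros q Hq [u [v [Hu [Hv Hw]]]].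
exists u, v; assert (Eu := f_eq_refl u (proj1 (le_conds Hq))).
assert (Ev := f_eq_refl v (proj1 (le_conds Hq))).
split; [| split]; [| | assumption].
- refine (f_upair_eq Eu _ _ Hu); eapply f_eq_mono; eassumption.
- refine (f_upair_eq Ev _ _ Hv); eapply f_eq_mono; eassumption.
Qed.

Lemma f_or_eq_check z x y p : p ∈ conds P ->
  z = x \/ z = y -> f_or (f_eq (check z) (check x)) (f_eq (check z) (check y)) P p.
Proof.
intros Hp Hz q Hq; exists q; split; [eauto |].
destruct Hz as [-> | ->]; [left | right]; apply f_eq_refl; now apply (le_conds Hq).
Qed.

Lemma f_upair_check x y p : p ∈ conds P ->
  f_upair (check (upair x y)) (check x) (check y) P p.
Proof.
intros Hp z; split; intros q Hq Hz.
- apply f_mem_check in Hz; apply (densely_imp Hz).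
  intros r Hr [j [Hj E]]; apply upair_spec in Hj as [-> | ->]; auto.
- apply f_mem_local; [now apply (le_conds Hq) |].
  apply (densely_imp Hz); intros r Hr [E | E];
    (eapply f_mem_eq_l; [apply f_eq_sym; exact E |]; apply check_mem;
     [now apply (le_conds Hr) | apply upair_spec; auto]).
Qed.

Lemma f_upair_check_inv u x y p : p ∈ conds P ->
  f_upair (check u) (check x) (check y) P p -> u = upair x y.
Proof.
intros Hp H; apply extensionality; intro z; rewrite upair_spec; split.
- intro Hz; destruct (H (check z)) as [H1 _].
  assert (Hz' := H1 p (le_refl Hp) (check_mem Hp Hz)).
  apply densely_here in Hz' as [q [Hq [E | E]]]; auto;
    apply check_eq_inv in E; auto; now apply (le_conds Hq).
- intro Hz; destruct (H (check z)) as [_ H2].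
  eapply check_mem_inv; [exact Hp | apply (H2 p (le_refl Hp)), f_or_eq_check; auto].
Qed.

Lemma f_opair_check x y p : p ∈ conds P ->
  f_opair (check (opair x y)) (check x) (check y) P p.
Proof.
intro Hp; apply f_opair_spec; intros q Hq; exists q; split; [eauto |].
assert (Hq' := proj1 (le_conds Hq)).
exists (check (upair x x)), (check (upair x y)).
repeat split; now apply f_upair_check.
Qed.

Lemma f_upair_l σ τ ρ p : p ∈ conds P -> f_upair σ τ ρ P p -> f_mem τ σ P p.
Proof.
intros Hp H; apply (proj2 (H τ)); [auto |]; intros q Hq; exists q; split; [eauto |].
left; apply f_eq_refl; now apply (le_conds Hq).
Qed.

Lemma f_upair_r σ τ ρ p : p ∈ conds P -> f_upair σ τ ρ P p -> f_mem ρ σ P p.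
Proof.
intros Hp H; apply (proj2 (H ρ)); [auto |]; intros q Hq; exists q; split; [eauto |].
right; apply f_eq_refl; now apply (le_conds Hq).
Qed.

Lemma f_mem_check_here σ τ y p : p ∈ conds P -> f_eq τ (check y) P p -> f_mem σ τ P p ->
  exists q j, le P q p /\ j ∈ y /\ f_eq σ (check j) P q.
Proof.
intros Hp E Hm.
assert (Hm' : f_mem σ (check y) P p) by (eapply f_mem_eq_r; eassumption).
apply f_mem_check, densely_here in Hm' as [q [Hq [j [Hj Ej]]]]; eauto.
Qed.

(** A name of a member of a check name is identified with one particular check name only below a
    stronger condition. So u, v, σ and τ are decided in turn, at p2, p3, p4 and p5; below p5 only
    check names remain and the Kuratowski pair is read off in V. *)
Lemma f_opair_check_inv w σ τ p : p ∈ conds P ->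
  f_opair (check w) σ τ P p ->
  exists q x y, le P q p /\ w = opair x y /\ f_eq σ (check x) P q /\ f_eq τ (check y) P q.
Proof.
intros Hp H.
apply f_opair_spec, densely_here in H as [p1 [L1 [u [v [Hu [Hv Hw]]]]]]; [| assumption].
assert (C1 := proj1 (le_conds L1)).
destruct (@f_mem_check_here u (check w) w p1 C1) as [p2 [u0 [L2 [Hu0 Eu]]]];
  [now apply f_eq_refl | now apply f_upair_l in Hw |].
assert (C2 := proj1 (le_conds L2)).
destruct (@f_mem_check_here v (check w) w p2 C2) as [p3 [v0 [L3 [Hv0 Ev]]]];
  [now apply f_eq_refl | apply (f_mem_mono L2); now apply f_upair_r in Hw |].
assert (C3 := proj1 (le_conds L3)).
assert (Eu3 := f_eq_mono L3 Eu).
assert (L31 : le P p3 p1) by eauto.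
destruct (@f_mem_check_here σ u u0 p3 C3 Eu3) as [p4 [x [L4 [Hx Eσ]]]];
  [apply (f_mem_mono L31); now apply f_upair_l in Hu |].
assert (C4 := proj1 (le_conds L4)).
assert (L41 : le P p4 p1) by eauto.
destruct (@f_mem_check_here τ v v0 p4 C4 (f_eq_mono L4 Ev)) as [p5 [y [L5 [Hy Eτ]]]];
  [apply (f_mem_mono L41); now apply f_upair_r in Hv |].
assert (C5 := proj1 (le_conds L5)).
assert (L51 : le P p5 p1) by eauto.
assert (L53 : le P p5 p3) by eauto.
assert (Eσ5 := f_eq_mono L5 Eσ).
assert (Eu5 := f_eq_mono L53 Eu3); assert (Ev5 := f_eq_mono L53 Ev).
assert (E1 := f_upair_check_inv C5 (f_upair_eq Eu5 Eσ5 Eσ5 (f_upair_mono L51 Hu))).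
assert (E2 := f_upair_check_inv C5 (f_upair_eq Ev5 Eσ5 Eτ (f_upair_mono L51 Hv))).
assert (E3 := f_upair_check_inv C5
  (f_upair_eq (f_eq_refl _ C5) Eu5 Ev5 (f_upair_mono L51 Hw))).
exists p5, x, y; subst; repeat split; eauto.
Qed.

Lemma f_countable_check a p : p ∈ conds P -> countable a -> f_countable (check a) P p.
Proof.
intros Hp [g [gω ginj]] q Hq; exists q; split; [eauto |].
set (G := image (fun x => opair x (g x)) a); exists (check G); split.
- intros y r Hr Hy; apply f_mem_check in Hy; apply (densely_imp Hy).
  intros t Ht [x [Hx E]]; exists (check (g x)); intros t' Ht'.
  apply (f_eq_mono Ht') in E; assert (Ct := proj1 (le_conds Ht')).
  exists t'; split; [auto |]; exists (check (opair x (g x))); split; [| split].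
  + apply check_mem; auto.
  + apply check_mem; [assumption |]; apply image_spec; eauto.
  + eapply f_opair_eq; [apply f_eq_sym; exact E | now apply f_eq_refl |].
    now apply f_opair_check.
- intros y n y' n' w w' r Hr [Hw [Hw' [Hp1 Hp2]]].
  (* Densely, both pairs are decoded to points of the graph of g. Then y = y' and n = n' each amount
     to x = x', the latter by injectivity of g. *)
  assert (HD : densely_below P r (fun t => exists x x', x ∈ a /\ x' ∈ a /\
      f_eq y (check x) P t /\ f_eq n (check (g x)) P t /\
      f_eq y' (check x') P t /\ f_eq n' (check (g x')) P t)).
  { assert (Hdec : forall (w y n : name V) t, le P t r -> f_mem w (check G) P r -> f_opair w y n P r ->
      exists t' x, le P t' t /\ x ∈ a /\ f_eq y (check x) P t' /\ f_eq n (check (g x)) P t').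
    { clear - gω ginj P_forcing; intros w y n t Ht Hw Ho.
      assert (Ct := proj1 (le_conds Ht)).
      destruct (@f_mem_check_here w (check G) G t Ct) as [t1 [w0 [L1 [Hw0 E]]]];
        [now apply f_eq_refl | now apply (f_mem_mono Ht) |].
      assert (C1 := proj1 (le_conds L1)).
      apply image_spec in Hw0 as [x [Hx ->]].
      assert (Ho' : f_opair (check (opair x (g x))) y n P t1).
      { assert (L1r : le P t1 r) by eauto.
        apply (f_opair_mono L1r), f_opair_spec in Ho.
        apply f_opair_spec, (densely_imp Ho).
        intros t2 L2 [u [v [Hu [Hv Hw']]]]; exists u, v; split; [| split]; auto.
        assert (C2 := proj1 (le_conds L2)).
        exact (f_upair_eq (f_eq_mono L2 E) (f_eq_refl u C2) (f_eq_refl v C2) Hw'). }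
      apply f_opair_check_inv in Ho' as [t2 [x' [k [L2 [Ew [E1 E2]]]]]]; [| assumption].
      apply opair_inj in Ew as [<- <-]; exists t2, x; eauto. }
    intros t Ht.
    destruct (Hdec w y n t Ht Hw Hp1) as [t1 [x [L1 [Hx [E1 E2]]]]].
    assert (L1r : le P t1 r) by eauto.
    destruct (Hdec w' y' n' t1 L1r Hw' Hp2) as [t2 [x' [L2 [Hx' [E3 E4]]]]].
    exists t2; split; [eauto |]; exists x, x'.
    repeat split; auto; now apply (f_eq_mono L2). }
  split; intros s Hs E; apply f_eq_local; try (now apply (le_conds Hs));
    intros t Ht; assert (Ltr : le P t r) by eauto;
    destruct (HD t Ltr) as [t1 [L1 [x [x' [Hx [Hx' [E1 [E2 [E3 E4]]]]]]]]];
    exists t1; (split; [assumption |]);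
    assert (C1 := proj1 (le_conds L1)); assert (L1s : le P t1 s) by eauto;
    apply (f_eq_mono L1s) in E;
    assert (x = x').
  + apply (check_eq_inv C1); eapply f_eq_trans; [apply f_eq_sym; exact E1 |].
    eapply f_eq_trans; [exact E | exact E3].
  + subst x'; eapply f_eq_trans; [exact E2 | now apply f_eq_sym].
  + apply ginj; auto.
    apply (check_eq_inv C1); eapply f_eq_trans; [apply f_eq_sym; exact E2 |].
    eapply f_eq_trans; [exact E | exact E4].
  + subst x'; eapply f_eq_trans; [exact E1 | now apply f_eq_sym].
Qed.

(** * Interpreting a name by a filter that meets ω1 dense sets *)

Context (P_FA : meets_dense P).

(* [φ t ξ] stands for "t forces ξ ∈ x" for some name x of a set of ground model
   elements. *)
Definition decided (φ : V -> V -> Prop) t a : Prop :=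
  forall ξ, ξ ∈ a -> φ t ξ \/ forall t', le P t' t -> ~ φ t' ξ.

(** That is, t forces ξ into the symmetric difference of x and y; the quantifier over t' is the
    forcing of a negation. *)
Definition differs (φ : V -> V -> Prop) t y ξ : Prop :=
  ξ ∈ y /\ (forall t', le P t' t -> ~ φ t' ξ) \/ ~ ξ ∈ y /\ φ t ξ.

Section Abstract.
Context (φ : V -> V -> Prop) (φ_mono : forall ξ, monotone (fun _ t => φ t ξ)).

Lemma φ_le t t' ξ : le P t' t -> φ t ξ -> φ t' ξ.
Proof. intro Ht; apply (@φ_mono ξ t t' Ht). Qed.

Lemma decided_mono t t' a : le P t' t -> decided φ t a -> decided φ t' a.
Proof.
intros Ht Hd ξ Hξ; destruct (Hd ξ Hξ) as [H | H]; [left | right].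
- now apply (φ_le Ht).
- intros u Hu; apply H; eauto.
Qed.

(** This lets an approximation be computed at a condition of M when it is wanted at an extension
    that need not lie in M. *)
Lemma decided_sep t t' a : t ∈ conds P -> le P t' t -> decided φ t a ->
  sep a (φ t') = sep a (φ t).
Proof.
intros Ct Ht Hd; apply extensionality; intro ξ; rewrite !sep_spec.
split; intros [Hξ H]; split; auto; [| now apply (φ_le Ht)].
destruct (Hd ξ Hξ) as [| Hn]; [assumption |]; now apply Hn in H.
Qed.

Lemma differs_mono t t' y ξ : le P t' t -> differs φ t y ξ -> differs φ t' y ξ.
Proof.
intros Ht [[Hy H] | [Hy H]]; [left | right]; split; auto.
- intros u Hu; apply H; eauto.
- now apply (φ_le Ht).
Qed.

(* If no t decides that x is guessed, then the ω1 dense classes "t decides m ∩ x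
   (when m is countable) and forces x ∩ M ≠ m ∩ M" are met by a filter, whose
   interpretation of x contradicts that M is guessing in V. *)
Lemma guessed_below M s X :
  guessing M -> card_le M omega1 -> X ∈ M -> s ∈ conds P ->
  (forall t ξ, le P t s -> φ t ξ -> ξ ∈ X) ->
  (forall a t, a ∈ M -> countable a -> le P t s ->
     exists t', le P t' t /\ decided φ t' a /\ sep a (φ t') ∈ M) ->
  exists t y, le P t s /\ y ∈ M /\
    forall t' ξ, le P t' t -> ξ ∈ M -> ~ differs φ t' y ξ.
Proof.
intros HM Mω1 XM Hs HX Hcap; apply NNPP; intro Hn.
assert (Hdiff : forall t y, le P t s -> y ∈ M ->
  exists t' ξ, le P t' t /\ ξ ∈ M /\ differs φ t' y ξ).
{ intros t y Ht Hy; apply NNPP; intro Hn'; apply Hn; exists t, y.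
  split; [| split]; auto.
  intros t' ξ Ht' Hξ Hd; apply Hn'; exists t', ξ; auto. }
destruct (@P_FA s Hs M (fun m r =>
  (countable m -> decided φ r m /\ sep m (φ r) ∈ M) /\
  exists ξ, ξ ∈ M /\ differs φ r m ξ)) as [G [Gs [Gdir Gmeet]]]; [assumption | |].
{ intros m q Hm Hq; destruct (Hdiff q m Hq Hm) as [q1 [ξ [H1 [Hξ Hd]]]].
  destruct (classic (countable m)) as [Hc | Hc].
  - destruct (Hcap m q1) as [q2 [H2 [Hdec Hsep]]]; eauto.
    exists q2; split; [eauto |]; split; [auto |].
    exists ξ; split; [assumption | now apply (differs_mono H2)].
  - exists q1; split; [assumption |]; split; [tauto | eauto]. }
set (x := sep X (fun ξ => exists t, G t /\ φ t ξ)).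
assert (xP : forall ξ, ξ ∈ x <-> exists t, G t /\ φ t ξ).
{ intro ξ; unfold x; rewrite sep_spec; split; [tauto |].
  intros [t [Gt Ht]]; split; [| eauto]; eauto. }
assert (Hx : exists y, y ∈ M /\ y ∩ M = x ∩ M).
{ apply (HM X x); [assumption | intros ξ Hξ; now apply sep_spec in Hξ |].
  intros a Ha Hc; destruct (Gmeet a Ha) as [t [Gt [Ht _]]].
  destruct (Ht Hc) as [Hdec Hsep].
  (* The condition t chosen for a already computes a ∩ x: any t' ∈ G putting ξ into x is compatible
     with t, so t cannot have excluded ξ. *)
  replace (a ∩ x) with (sep a (φ t)); [assumption |].
  apply extensionality; intro ξ; rewrite cap_spec, sep_spec, xP.
  split; intros [Hξ H]; split; eauto.
  destruct H as [t' [Gt' Ht']]; destruct (Hdec ξ Hξ) as [| Hneg]; [assumption |].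
  destruct (Gdir t t') as [u [H1 H2]]; auto.
  destruct (Hneg u H1); now apply (φ_le H2). }
destruct Hx as [y [Hy E]].
assert (yP : forall ξ, ξ ∈ M -> (ξ ∈ y <-> ξ ∈ x)).
{ intros ξ Hξ; assert (H : ξ ∈ y ∩ M <-> ξ ∈ x ∩ M) by now rewrite E.
  rewrite !cap_spec in H; tauto. }
destruct (Gmeet y Hy) as [t [Gt [_ [ξ [Hξ [[Hξy H] | [Hξy H]]]]]]].
- apply yP, xP in Hξy as [t' [Gt' Ht']]; [| assumption].
  destruct (Gdir t t') as [u [H1 H2]]; auto.
  apply (H u H1); now apply (φ_le H2).
- apply Hξy, yP, xP; eauto.
Qed.

End Abstract.

Lemma f_mem_check_mono (x : name V) ξ : monotone (f_mem (check ξ) x).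
Proof. apply f_mem_mono; assumption. Qed.

(** * P-IGMP *)

Lemma f_cap_eq (b b' a a' x : name V) p :
  f_eq b b' P p -> f_eq a a' P p -> f_cap b a x P p -> f_cap b' a' x P p.
Proof.
intros Eb Ea H z; destruct (H z) as [H1 H2]; split; intros q Hq Hz.
- destruct (H1 q Hq) as [Ha Hx].
  + eapply f_mem_eq_r; [| exact Hz].
    apply f_eq_sym; eapply f_eq_mono; eassumption.
  + split; [| assumption].
    eapply f_mem_eq_r; [eapply f_eq_mono; eassumption | assumption].
- destruct Hz as [Ha Hx].
  eapply f_mem_eq_r; [eapply f_eq_mono; eassumption |].
  apply (H2 q Hq); split; [| assumption].
  eapply f_mem_eq_r; [| exact Ha].
  apply f_eq_sym; eapply f_eq_mono; eassumption.
Qed.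

Lemma f_cap_comm (b x y : name V) p : f_cap b x y P p -> f_cap b y x P p.
Proof.
intros H z; destruct (H z) as [H1 H2]; split; intros q Hq Hz.
- destruct (H1 q Hq Hz); split; assumption.
- destruct Hz; apply (H2 q Hq); split; assumption.
Qed.

Let forces_in (x : name V) : V -> V -> Prop := fun t ξ => f_mem (check ξ) x P t.

Lemma f_cap_check (x : name V) a p : p ∈ conds P -> decided (forces_in x) p a ->
  f_cap (check (sep a (forces_in x p))) (check a) x P p.
Proof.
intros Hp Hd z; split; intros q Hq Hz.
- apply f_mem_check in Hz.
  assert (Hz' : densely_below P q (fun r => f_mem z (check a) P r /\ f_mem z x P r)).
  { apply (densely_imp Hz); intros r Hr [j [Hj E]].
    apply sep_spec in Hj as [Hj Hjx]; apply f_eq_sym in E.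
    split; eapply f_mem_eq_l; try exact E.
    - apply check_mem; [now apply (le_conds Hr) | assumption].
    - eapply f_mem_mono; [| exact Hjx]; eauto. }
  split; apply f_mem_local; try now apply (le_conds Hq).
  + now apply (densely_imp Hz').
  + now apply (densely_imp Hz').
- destruct Hz as [Hza Hzx]; apply f_mem_check in Hza.
  apply f_mem_check.
  apply (densely_imp Hza); intros r Hr [j [Hj E]].
  exists j; split; [| assumption]; apply sep_spec; split; [assumption |].
  destruct (Hd j Hj) as [| Hn]; [assumption |].
  destruct (Hn r); [eauto |].
  eapply f_mem_eq_l; [exact E |]; eapply f_mem_mono; eassumption.
Qed.

(** With [f_cap_check], this is the bridge between the forcing language and the abstract relation:
    to make a ∩ x a prescribed ground model set is to decide x on a. *)
Lemma f_cap_check_inv (x : name V) a b p : p ∈ conds P ->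
  f_cap (check b) (check a) x P p -> decided (forces_in x) p a /\ b = sep a (forces_in x p).
Proof.
intros Hp H.
assert (H1 : forall ξ, ξ ∈ b -> ξ ∈ a /\ forces_in x p ξ).
{ intros ξ Hξ; destruct (proj1 (H (check ξ)) p) as [Ha Hx]; auto.
  - now apply check_mem.
  - split; [exact (check_mem_inv Hp Ha) | exact Hx]. }
assert (H2 : forall ξ q, le P q p -> ξ ∈ a -> forces_in x q ξ -> ξ ∈ b).
{ intros ξ q Hq Hξ Hx; assert (Cq := proj1 (le_conds Hq)).
  apply (check_mem_inv Cq), (proj2 (H (check ξ)) q Hq).
  split; [now apply check_mem | exact Hx]. }
split.
- intros ξ Hξ; destruct (classic (ξ ∈ b)) as [Hb | Hb]; [left; now apply H1 |].
  right; intros q Hq Hx; eauto.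
- apply extensionality; intro ξ; rewrite sep_spec; split; [apply H1 |].
  intros [Ha Hx]; eauto.
Qed.

Lemma f_sub_check_inv (x X : name V) X0 p q ξ : f_sub x X P p ->
  f_eq X (check X0) P p -> le P q p -> forces_in x q ξ -> ξ ∈ X0.
Proof.
intros Hsub E Hq Hx; assert (Cq := proj1 (le_conds Hq)).
apply (check_mem_inv Cq); eapply f_mem_eq_r.
- eapply f_eq_mono; eassumption.
- exact (Hsub _ q Hq Hx).
Qed.

(* The filter given by FA interprets the name of an injection on a'. *)
Lemma f_countable_inv a a' p : p ∈ conds P -> f_countable (check a) P p ->
  a' ⊆ a -> card_le a' omega1 -> countable a'.
Proof.
intros Hp Hc Ha' Hcard.
apply densely_here in Hc as [q [Hq [f [Hf1 Hf2]]]]; [| assumption].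
assert (Cq := proj1 (le_conds Hq)).
set (D := fun ξ r => exists k w, k ∈ omega /\ f_mem w f P r /\
  f_opair w (check ξ) (check k) P r).
destruct (@P_FA q Cq a' D) as [G [Gq [Gdir Gmeet]]]; [assumption | |].
{ intros ξ r Hξ Hr; assert (Cr := proj1 (le_conds Hr)).
  assert (Hmem : f_mem (check ξ) (check a) P r) by (apply check_mem; auto).
  destruct (densely_here Cr (Hf1 (check ξ) r Hr Hmem)) as [r1 [L1 [n Hn]]].
  assert (C1 := proj1 (le_conds L1)).
  destruct (densely_here C1 Hn) as [r2 [L2 [w [Hnω [Hw Hp1]]]]].
  assert (C2 := proj1 (le_conds L2)).
  apply f_mem_check in Hnω.
  destruct (densely_here C2 Hnω) as [r3 [L3 [k [Hk E]]]].
  assert (C3 := proj1 (le_conds L3)).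
  exists r3; split; [eauto |]; exists k, w; split; [| split].
  - assumption.
  - eapply f_mem_mono; eassumption.
  - apply (f_opair_eq (f_eq_refl _ C3) E).
    eapply f_opair_mono; eassumption. }
set (h := fun ξ => the (fun k => exists r, G r /\ exists w, k ∈ omega /\
  f_mem w f P r /\ f_opair w (check ξ) (check k) P r)).
assert (hP : forall ξ, ξ ∈ a' -> exists r, G r /\ exists w, h ξ ∈ omega /\
  f_mem w f P r /\ f_opair w (check ξ) (check (h ξ)) P r).
{ intros ξ Hξ; apply (the_spec (C := fun k => exists r, G r /\ exists w, k ∈ omega /\
    f_mem w f P r /\ f_opair w (check ξ) (check k) P r)).
  destruct (Gmeet ξ Hξ) as [r [Gr [k [w Hkw]]]]; exists k, r; eauto. }
exists h; split.
- intros ξ Hξ; now destruct (hP ξ Hξ) as [r [_ [w [Hω _]]]].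
- intros ξ ξ' Hξ Hξ' E.
  destruct (hP ξ Hξ) as [r [Gr [w [_ [Hw Ho]]]]].
  destruct (hP ξ' Hξ') as [r' [Gr' [w' [_ [Hw' Ho']]]]].
  rewrite <- E in Ho'.
  destruct (Gdir r r' Gr Gr') as [t [L1 L2]].
  assert (Ct := proj1 (le_conds L1)).
  assert (Ltq : le P t q) by eauto.
  (* The common extension t sees both pairs in f with the same second coordinate, so the injectivity
     forced by q identifies the first coordinates. *)
  apply (check_eq_inv Ct).
  apply (proj2 (Hf2 _ _ _ _ w w' t Ltq
    (conj (f_mem_mono L1 Hw) (conj (f_mem_mono L2 Hw')
      (conj (f_opair_mono L1 Ho) (f_opair_mono L2 Ho')))))).
  + now apply le_refl.
  + now apply f_eq_refl.
Qed.

Lemma preserves_omega1 : omega1_preserving P.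
Proof.
intros p Hp q Hq Hc; assert (Cq := proj1 (le_conds Hq)).
apply (@hartogs_not_le V omega); change (countable (@omega1 V)).
apply (@f_countable_inv omega1 omega1 q); auto using card_le_sub.
- now intros z Hz.
- apply card_le_sub; now intros z Hz.
Qed.

(** The set a may be too large for one application of the forcing axiom. But an uncountable a
    contains a copy of ω1, and the filter need only interpret the injection there. *)
Lemma f_countable_absolute a p : p ∈ conds P -> f_countable (check a) P p -> countable a.
Proof.
intros Hp Hc; apply NNPP; intro Ha.
destruct (uncountable_spec Ha) as [f [fa finj]].
apply (@hartogs_not_le V omega), card_le_trans with (image f omega1).
- exists f; split; [| assumption]; intros z Hz; apply image_spec; eauto.
- apply (@f_countable_inv a (image f omega1) p); auto using card_le_image.
  intros z Hz; apply image_spec in Hz as [t [Ht ->]]; auto.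
Qed.

Lemma f_countable_mono (a : name V) : monotone (f_countable a).
Proof. intros p q Hqp; now apply densely_mono. Qed.

Lemma f_countable_eq (a b : name V) p :
  f_eq a b P p -> f_countable a P p -> f_countable b P p.
Proof.
intros E HD; apply (densely_imp HD); intros q Hq [f [H1 H2]].
exists f; split; [| assumption]; intros y r Hr Hy; apply (H1 y r Hr).
assert (Lrp : le P r p) by eauto.
eapply f_mem_eq_r; [apply f_eq_sym; exact (f_eq_mono Lrp E) | assumption].
Qed.

(** Obtaining a guess from the approximations is [guessed_below], applied below every condition.
    Conversely, let y guess x. A countable a ∈ M is countable in V, hence a subset of M, so a ∩ x
    can be computed from y and is the set a ∩ y ∩ X of V; that this set lies in M follows from
    guessing in V. *)
Lemma forced_guessing M : guessing M -> card_le M omega1 ->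
  (forall a, a ∈ M -> countable a -> a ⊆ M) -> forced P (f_guessing (check M)).
Proof.
intros HM Mω1 Msub p Hp X x q Hq [HX Hx].
(* X is only a name of a member of M; which member it is gets decided densely. *)
assert (Hdec : forall s, le P s q -> exists s1 X0, le P s1 s /\ X0 ∈ M /\
  forall t ξ, le P t s1 -> forces_in x t ξ -> ξ ∈ X0).
{ intros s Hs; assert (Cs := proj1 (le_conds Hs)).
  destruct (@f_mem_check_here X (check M) M s Cs) as [s1 [X0 [L1 [HX0 EX]]]];
    [now apply f_eq_refl | exact (f_mem_mono Hs HX) |].
  exists s1, X0; split; [assumption |]; split; [assumption |].
  intros t ξ Ht Hξ; refine (f_sub_check_inv _ EX Ht Hξ).
  intros z u Hu; apply Hx; eauto. }
split; intros r Hr H.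
- intros s Hs; assert (Lsq : le P s q) by eauto.
  destruct (Hdec s Lsq) as [s1 [X0 [L1 [HX0 Hx1]]]].
  assert (C1 := proj1 (le_conds L1)).
  destruct (@guessed_below (forces_in x) (fun ξ => f_mem_check_mono (x := x) (ξ := ξ))
    M s1 X0) as [t [y [Ht [Hy Hnd]]]]; try assumption.
  + intros a t Ha Hc Ht; assert (Ct := proj1 (le_conds Ht)).
    assert (Ltr : le P t r) by eauto.
    assert (Hb := H (check a) t Ltr (conj (check_mem Ct Ha)
      (f_countable_check Ct Hc))).
    apply densely_here in Hb as [t1 [Lt1 [b [Hb Hcap]]]]; [| assumption].
    assert (Ct1 := proj1 (le_conds Lt1)).
    destruct (@f_mem_check_here b (check M) M t1 Ct1)
      as [t2 [b0 [Lt2 [Hb0 Eb]]]]; [now apply f_eq_refl | assumption |].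
    assert (Ct2 := proj1 (le_conds Lt2)).
    assert (Hcap2 : f_cap b (check a) x P t2).
    { intro z; destruct (Hcap z); split; intros u Hu; eauto. }
    apply (f_cap_eq Eb (f_eq_refl _ Ct2)), f_cap_check_inv in Hcap2
      as [Hd ->]; [| assumption].
    exists t2; split; [eauto | auto].
  + exists t; split; [eauto |]; exists (check y).
    assert (Ct := proj1 (le_conds Ht)).
    split; [now apply check_mem |].
    intros t1 Lt1; exists t1; split; [eauto |]; exists (check (y ∩ M)).
    assert (Ct1 := proj1 (le_conds Lt1)).
    split.
    (* The set y ∩ M is read first as the approximation on y to the name of M, and below as the
       approximation on M to x, so [f_cap_check] serves for both halves. *)
    * replace (y ∩ M) with (sep y (forces_in (check M) t1)).
      -- apply f_cap_check; [assumption |]; intros ξ Hξ.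
         destruct (classic (ξ ∈ M)) as [HξM | HξM]; [left; now apply check_mem |].
         right; intros t' Ht' Hf; apply HξM.
         apply (check_mem_inv (proj1 (le_conds Ht')) Hf).
      -- apply extensionality; intro ξ; rewrite sep_spec, cap_spec.
         split; intros [Hξ H']; split; auto; [| now apply check_mem].
         exact (check_mem_inv Ct1 H').
    (* For ξ ∈ y, the absence of a difference says that no extension excludes ξ; so ξ is forced into
       x densely, and hence by t1. *)
    * assert (Hy1 : forall ξ, ξ ∈ M -> ξ ∈ y -> forces_in x t1 ξ).
      { intros ξ HξM Hξy; apply f_mem_local; [assumption |].
        intros u Hu; apply NNPP; intro Hn; apply (Hnd u ξ); [eauto | assumption |].
        left; split; [assumption |]; intros t' Ht' Hf; apply Hn; eauto. }
      assert (Hy2 : forall ξ t', ξ ∈ M -> le P t' t1 -> forces_in x t' ξ -> ξ ∈ y).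
      { intros ξ t' HξM Ht' Hf; apply NNPP; intro Hn; apply (Hnd t' ξ); eauto.
        right; auto. }
      apply f_cap_comm; replace (y ∩ M) with (sep M (forces_in x t1)).
      -- apply f_cap_check; [assumption |]; intros ξ Hξ.
         destruct (classic (ξ ∈ y)) as [Hξy | Hξy]; [left; auto | right].
         intros t' Ht' Hf; eauto.
      -- apply extensionality; intro ξ; rewrite sep_spec, cap_spec.
         split; intros [Hξ H']; split; eauto.
- intros a s Hs [Ha Hc] s' Hs'.
  assert (Cs' := proj1 (le_conds Hs')); assert (Lsr : le P s' r) by eauto.
  destruct (Hdec s') as [s1 [X0 [L1 [HX0 Hx1]]]]; [eauto |].
  assert (C1 := proj1 (le_conds L1)); assert (L1s : le P s1 s) by eauto.
  destruct (@f_mem_check_here a (check M) M s1 C1) as [s2 [a0 [L2 [Ha0 Ea]]]];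
    [now apply f_eq_refl | exact (f_mem_mono L1s Ha) |].
  assert (C2 := proj1 (le_conds L2)); assert (L2r : le P s2 r) by eauto.
  destruct (H s2 L2r) as [s3 [L3 [y [Hy Hb]]]].
  assert (C3 := proj1 (le_conds L3)).
  destruct (@f_mem_check_here y (check M) M s3 C3) as [s4 [y0 [L4 [Hy0 Ey]]]];
    [now apply f_eq_refl | assumption |].
  destruct (Hb s4 L4) as [t [L5 [b [Hby Hbx]]]].
  assert (Ct := proj1 (le_conds L5)); assert (Lt2 : le P t s2) by eauto.
  apply (f_eq_mono Lt2) in Ea; apply (f_eq_mono L5) in Ey.
  assert (Lts : le P t s) by eauto; assert (Lt1 : le P t s1) by eauto.
  assert (Hca : countable a0).
  { apply (f_countable_absolute Ct), (f_countable_eq Ea).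
    now apply (f_countable_mono Lts). }
  assert (Hy1 : forall ξ, ξ ∈ M -> ξ ∈ y0 -> forces_in x t ξ).
  { intros ξ HξM Hξy; apply (proj1 (Hbx (check ξ)) t); [auto |].
    apply (proj2 (Hby (check ξ)) t); [auto |]; split; [| now apply check_mem].
    eapply f_mem_eq_r; [apply f_eq_sym; exact Ey | now apply check_mem]. }
  assert (Hy2 : forall ξ u, ξ ∈ M -> le P u t -> forces_in x u ξ -> ξ ∈ y0).
  { intros ξ u HξM Hu Hf; assert (Cu := proj1 (le_conds Hu)).
    apply (check_mem_inv Cu); eapply f_mem_eq_r; [exact (f_eq_mono Hu Ey) |].
    apply (proj1 (Hby (check ξ)) u Hu), (proj2 (Hbx (check ξ)) u Hu).
    split; [assumption | now apply check_mem]. }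
  (* The guess y0 need not be a subset of X0, but y0 ∩ M is, because its elements are forced into x.
     Hence y0 guesses the bounded set y0 ∩ X0, and guessing in V, read from right to left, gives the
     approximations. *)
  assert (Hg : a0 ∩ (y0 ∩ X0) ∈ M).
  { apply (HM X0 (y0 ∩ X0)); try assumption.
    - intros ξ Hξ; now apply cap_spec in Hξ.
    - exists y0; split; [assumption |].
      apply extensionality; intro ξ; rewrite !cap_spec.
      split; [| tauto]; intros [Hξy HξM]; repeat split; auto.
      apply (Hx1 t ξ); auto. }
  exists t; split; [eauto |]; exists (check (a0 ∩ (y0 ∩ X0))).
  split; [now apply check_mem |].
  apply (f_cap_eq (f_eq_refl _ Ct) (f_eq_sym Ea)).
  replace (a0 ∩ (y0 ∩ X0)) with (sep a0 (forces_in x t)).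
  + apply f_cap_check; [assumption |]; intros ξ Hξ.
    assert (HξM := Msub a0 Ha0 Hca ξ Hξ).
    destruct (classic (ξ ∈ y0)) as [Hξy | Hξy]; [left; auto | right].
    intros u Hu Hf; eauto.
  + apply extensionality; intro ξ; rewrite sep_spec, !cap_spec; split.
    * intros [Hξ Hf]; assert (HξM := Msub a0 Ha0 Hca ξ Hξ).
      repeat split; [assumption | exact (Hy2 ξ t HξM (le_refl Ct) Hf) | exact (Hx1 t ξ Lt1 Hf)].
    * intros [Hξ [Hξy _]]; assert (HξM := Msub a0 Ha0 Hca ξ Hξ); auto.
Qed.
End Forcing.

Arguments monotone {V} P φ.
Arguments decided {V} P φ t a.
Arguments differs {V} P φ t y ξ.

(** * The forcing axiom below a given condition *)

Section Restriction.
Context {V : universe}.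
Implicit Types (P p q r : V).

Lemma conds_opair (A L : V) : conds (opair A L) = A.
Proof.
assert (H : exists L', opair A L = opair (conds (opair A L)) L').
{ apply (the_spec (C := fun A' => exists L', opair A L = opair A' L')); eauto. }
destruct H as [L' E]; now apply opair_inj in E.
Qed.

Lemma order_opair (A L : V) : order (opair A L) = L.
Proof.
assert (H : exists A', opair A L = opair A' (order (opair A L))).
{ apply (the_spec (C := fun L' => exists A', opair A L = opair A' L')); eauto. }
destruct H as [A' E]; now apply opair_inj in E.
Qed.

Lemma conds_restriction P p q :
  forcing_notion P -> q ∈ conds (restriction P p) <-> le P q p.
Proof.
intro HP; unfold restriction; rewrite conds_opair.
apply (@setof_bounded V (fun q => le P q p) (conds P)).
intros x Hx; now apply (le_conds HP Hx).
Qed.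

Lemma le_restriction P p q r :
  le (restriction P p) q r <-> le P q p /\ le P r p /\ le P q r.
Proof.
unfold le at 1, restriction; rewrite order_opair.
rewrite (@setof_bounded V (fun w => exists q r, w = opair q r /\
  le P q p /\ le P r p /\ le P q r) (order P)).
- split.
  + intros [q' [r' [E H]]]; now apply opair_inj in E as [-> ->].
  + intro H; now exists q, r.
- now intros w [q' [r' [-> [_ [_ H]]]]].
Qed.

Lemma FA_meets_dense K P : FA K omega1 -> restriction_closed K -> K P ->
  forcing_notion P -> meets_dense P.
Proof.
intros HFA HK KP HP p Hp I D HI HD.
set (d := fun i => sep (conds P) (fun r => le P r p /\ D i r)).
destruct (HFA (restriction P p)) with (D := image d I) as [G [[HG [_ [_ Hdir]]] Hmeet]].
- now apply HK.
- intros x Hx; apply image_spec in Hx as [i [Hi ->]]; split.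
  + intros r Hr; apply sep_spec in Hr as [_ [Hr _]]; now apply conds_restriction.
  + intros q Hq; apply conds_restriction in Hq; [| assumption].
    destruct (HD i q Hi Hq) as [r [Hr Hd]]; assert (Lrp := le_trans HP Hr Hq); exists r; split.
    * apply sep_spec; split; [now apply (le_conds HP Hr) | auto].
    * apply le_restriction; auto.
- apply card_le_trans with I; [apply card_le_image | assumption].
- exists (fun q => q ∈ G); split; [| split].
  + intros q Hq; now apply conds_restriction, HG.
  + intros q r Hq Hr; destruct (Hdir q r Hq Hr) as [s [_ [H1 H2]]].
    apply le_restriction in H1, H2; exists s; tauto.
  + intros i Hi; destruct (Hmeet (d i)) as [q [Hq Hd]]; [apply image_spec; eauto |].
    apply sep_spec in Hd; exists q; tauto.
Qed.

End Restriction.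


(** * Closing the models under operations *)

Section Closure.
Context {V : universe}.
Implicit Types (x y z u v a b e θ κ c p q r s t P M X : V) (F : V -> V).

Lemma upair_eq_cases u v u' v' :
  upair u v = upair u' v' -> u = u' /\ v = v' \/ u = v' /\ v = u'.
Proof.
intro E; assert (Hu : u ∈ upair u' v') by (rewrite <- E; apply upair_spec; auto).
apply upair_spec in Hu as [-> | ->].
- left; split; [reflexivity | now apply upair_inj in E].
- rewrite (upairC u' v') in E; right; split; [reflexivity | now apply upair_inj in E].
Qed.

Lemma card_lt_omega_adjoin z b : card_lt z omega -> card_lt (cup z (upair b b)) omega.
Proof.
intros [Hz Hn]; split.
- apply card_le_adjoin; [| assumption]; apply card_le_sub; now intros t Ht.
- intros [f [fz finj]]; apply Hn.
  assert (Hk : exists k, forall n, k < n -> f (num n) <> b).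
  { destruct (classic (exists k, f (num k) = b)) as [[k Ek] | Hk].
    - exists k; intros n Hkn En; rewrite <- Ek in En.
      apply finj, num_inj in En; [lia | apply num_omega | apply num_omega].
    - exists 0; eauto. }
  destruct Hk as [k Hk].
  (* By injectivity f takes the value b at most once; the shift by S k starts after that index, so
     the values stay in z. *)
  exists (fun t => f (num (S k + nat_of t))); split.
  + intros t Ht; specialize (fz _ (num_omega (S k + nat_of t))).
    apply cup_spec in fz as [| Hb]; [assumption |].
    apply upair_spec in Hb; destruct (Hk (S k + nat_of t)); [lia | tauto].
  + intros t t' Ht Ht' E; apply finj, num_inj in E; try apply num_omega.
    apply omega_spec in Ht as [m ->], Ht' as [m' ->].
    rewrite !nat_of_num in E; f_equal; lia.
Qed.

Lemma card_lt_empty x : (exists z, z ∈ x) -> card_lt empty x.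
Proof.
intros [z Hz]; split.
- apply card_le_sub; intros t Ht; now apply in_empty in Ht.
- intros [f [fe _]]; now apply fe, in_empty in Hz.
Qed.

Lemma upair_P_omega M u v : u ∈ M -> v ∈ M -> upair u v ∈ P_ omega M.
Proof.
intros Hu Hv; apply P_spec; split.
- intros z Hz; apply upair_spec in Hz as [-> | ->]; assumption.
- apply (@card_lt_mono _ _ (cup (cup empty (upair u u)) (upair v v))).
  + apply card_le_sub; intro z; rewrite !cup_spec, !upair_spec; tauto.
  + apply card_lt_omega_adjoin, card_lt_omega_adjoin, card_lt_empty.
    exists (num 0); apply num_omega.
Qed.

Definition operation θ F : Prop :=
  forall e, e ∈ P_ omega (H θ) -> F e ∈ P_ omega2 (H θ).

Definition closed_under F M : Prop := forall e, e ∈ P_ omega M -> F e ⊆ M.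

(** Stationarity offers a single F on finite sets, so closure conditions are merged into it one at a
    time. The arguments are coded by an unordered pair, which forgets their order; therefore both g
    u v and g v u become values, still a set of size below ω2. *)
Lemma add_binary θ F (g : V -> V -> V) : operation θ F ->
  (forall u v, u ∈ H θ -> v ∈ H θ -> g u v ∈ H θ) ->
  exists F', operation θ F' /\ forall M, closed_under F' M ->
    closed_under F M /\ forall u v, u ∈ M -> v ∈ M -> g u v ∈ M.
Proof.
intros HF Hg.
set (vals := fun e => setof (fun z => exists u v, e = upair u v /\ z = g u v)).
assert (vals_spec : forall u v z, z ∈ vals (upair u v) <-> z = g u v \/ z = g v u).
{ intros u v z; unfold vals; rewrite setof_bounded with (b := upair (g u v) (g v u)).
  - split.
    + intros [u' [v' [E ->]]]; apply upair_eq_cases in E as [[-> ->] | [-> ->]]; auto.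
    + intros [-> | ->]; [exists u, v | exists v, u]; auto using upairC.
  - intros t [u' [v' [E ->]]]; apply upair_spec.
    apply upair_eq_cases in E as [[-> ->] | [-> ->]]; auto. }
assert (vals_other : forall e, ~ (exists u v, e = upair u v) -> vals e = empty).
{ intros e He; apply extensionality; intro z; unfold vals.
  rewrite setof_bounded with (b := empty); [split |].
  - intros [u [v [E _]]]; destruct He; eauto.
  - intro Hz; now apply in_empty in Hz.
  - intros t [u [v [E _]]]; destruct He; eauto. }
exists (fun e => cup (F e) (vals e)); split.
- intros e He; assert (HFe := HF e He).
  apply P_spec in HFe as [FH Fcard]; apply P_spec in He as [He _].
  apply P_spec; destruct (classic (exists u v, e = upair u v)) as [[u [v E]] | Hn].
  + split.
    * intros z Hz; apply cup_spec in Hz as [Hz | Hz]; [auto |].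
      rewrite E in Hz, He; apply vals_spec in Hz.
      assert (Hu : u ∈ H θ) by (apply He, upair_spec; auto).
      assert (Hv : v ∈ H θ) by (apply He, upair_spec; auto).
      destruct Hz as [-> | ->]; auto.
    * apply (@card_lt_mono _ _ (cup (cup (F e) (upair (g u v) (g u v)))
        (upair (g v u) (g v u)))).
      -- apply card_le_sub; intro z; rewrite E, !cup_spec, vals_spec, !upair_spec; tauto.
      -- apply card_lt_hartogs_adjoin; [apply omega_le_omega1 |].
         now apply card_lt_hartogs_adjoin; [apply omega_le_omega1 |].
  + replace (cup (F e) (vals e)) with (F e); [auto |].
    rewrite vals_other by assumption; apply extensionality; intro z; rewrite cup_spec.
    split; [auto |]; intros [| Hz]; [assumption | now apply in_empty in Hz].
- intros M HM; split.
  + intros e He z Hz; apply (HM e He), cup_spec; auto.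
  + intros u v Hu Hv; apply (HM _ (upair_P_omega Hu Hv)), cup_spec; right.
    apply vals_spec; auto.
Qed.

Lemma empty_H θ : regular θ -> empty ∈ H θ.
Proof.
intros [_ [Hω _]]; apply H_spec.
rewrite transitive_trcl by (intros y Hy; now apply in_empty in Hy).
apply card_lt_empty; exists (num 0); apply Hω, num_omega.
Qed.

Lemma omega_sub_H θ : regular θ -> omega ⊆ H θ.
Proof.
intros [[Hord Hcard] [Hω _]] n Hn; apply H_spec.
rewrite transitive_trcl by now apply omega_ordinal.
split; [apply card_le_sub, (proj1 Hord); auto | auto].
Qed.

Lemma sub_H θ x y : y ∈ H θ -> x ⊆ y -> x ∈ H θ.
Proof.
intros Hy Hx; apply H_sub with y; [| assumption].
apply trcl_min; [apply trcl_transitive |].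
intros z Hz; now apply sub_trcl, Hx.
Qed.

(* Close under n ↦ the n-th element of a in a fixed enumeration of a. *)
Lemma add_countable θ F : regular θ -> operation θ F ->
  exists F', operation θ F' /\ forall M, (exists x, x ∈ M) -> closed_under F' M ->
    closed_under F M /\ forall a, a ∈ M -> countable a -> a ⊆ M.
Proof.
intros Hθ HF.
assert (Hω := omega_sub_H Hθ); assert (H0 := empty_H Hθ).
(* The indices n must themselves belong to M, so zero and successor are added as operations first.
   Outside its intended domain an operation takes the harmless value [empty]. *)
destruct (@add_binary θ F (fun _ _ => empty)) as [F1 [HF1 C1]]; [assumption | auto |].
destruct (@add_binary θ F1 (fun u _ =>
  if excluded_middle_informative (u ∈ omega) then succ u else empty))
  as [F2 [HF2 C2]]; [assumption | |].
{ intros u v Hu Hv; destruct excluded_middle_informative as [Hn | _]; [| assumption].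
  apply omega_spec in Hn as [n ->]; apply Hω; exact (num_omega (S n)). }
set (code := fun a => epsilon (inhabits (fun z => z)) (fun f : V -> V =>
  (forall z, z ∈ a -> f z ∈ omega) /\
  (forall z z', z ∈ a -> z' ∈ a -> f z = f z' -> z = z'))).
set (nth := fun a n => the (fun z => z ∈ a /\ code a z = n)).
destruct (@add_binary θ F2 (fun a n =>
  if excluded_middle_informative (nth a n ∈ a) then nth a n else empty))
  as [F3 [HF3 C3]]; [assumption | |].
{ intros a n Ha Hn; destruct excluded_middle_informative; [| assumption].
  now apply H_transitive with a. }
exists F3; split; [assumption |]; intros M [m Hm] HM.
destruct (C3 M HM) as [HM2 Hnth]; destruct (C2 M HM2) as [HM1 Hsucc].
destruct (C1 M HM1) as [HM0 Hempty]; split; [assumption |].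
assert (HnM : forall n, num n ∈ M).
{ induction n; [exact (Hempty m m Hm Hm) |].
  assert (Hs := Hsucc (num n) m IHn Hm); destruct excluded_middle_informative; [assumption |].
  destruct n0; apply num_omega. }
intros a Ha Hc z Hz.
destruct (epsilon_spec (inhabits (fun z => z)) _ Hc) as [codeω code_inj].
fold (code a) in codeω, code_inj.
assert (E : nth a (code a z) = z).
{ destruct (@the_spec V (fun t => t ∈ a /\ code a t = code a z)) as [Ht Et]; [eauto |].
  now apply code_inj in Et. }
assert (Hcode := codeω z Hz); apply omega_spec in Hcode as [n En].
assert (Hr := Hnth a (num n) Ha (HnM n)); rewrite <- En, E in Hr.
now destruct excluded_middle_informative.
Qed.

Lemma GMP_closed θ F : GMP V -> regular θ -> omega2 ⊆ θ -> operation θ F ->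
  exists M, M ≺ H θ /\ M ∈ P_ omega2 (H θ) /\ card_eq M omega1 /\ guessing M /\
    M ∩ omega2 ∈ omega2 /\ closed_under F M /\
    forall a, a ∈ M -> countable a -> a ⊆ M.
Proof.
intros HGMP Hθ H2 HF.
destruct (add_countable Hθ HF) as [F' [HF' C]].
destruct (HGMP θ Hθ H2) as [HP Hst].
destruct (Hst F' HF') as [M [HM [_ [Hδ HC]]]].
assert (HMP := HP M HM); destruct HM as [Hel [Hcard Hg]].
destruct (C M (proj1 Hel) HC) as [HCF Hsub].
exists M; repeat (split; [assumption |]); assumption.
Qed.

Lemma IGMP_of_GMP P : GMP V -> forcing_notion P -> meets_dense P -> IGMP P.
Proof.
intros HGMP HP HFA; split; [now apply preserves_omega1 |].
(* GMP speaks of every regular θ ≥ ω2, so ω2 already counts as sufficiently large. *)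
exists omega2; split; [apply ordinal_hartogs |].
intros θ Hθ H2; split; [now intros M [HM _] |].
intros F HF; destruct (GMP_closed (F := F) HGMP Hθ) as
  [M [Hel [HMP [Hcard [Hg [Hδ [HC Hsub]]]]]]]; [| assumption |].
- exact (proj1 (proj1 (proj1 Hθ)) _ H2).
- exists M; repeat (split; [assumption |]); auto.
  split; [| repeat (split; [assumption |]); assumption].
  repeat (split; [assumption |]).
  apply forced_guessing; auto; now apply card_eq_le.
Qed.

(** * The approximation property *)

(** The constant is the value at a pair of members of M, so some member is required. *)
Lemma add_constant θ F c : operation θ F -> c ∈ H θ ->
  exists F', operation θ F' /\ forall M, (exists x, x ∈ M) -> closed_under F' M ->
    closed_under F M /\ c ∈ M.
Proof.
intros HF Hc; destruct (@add_binary θ F (fun _ _ => c)) as [F' [HF' C]]; auto.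
exists F'; split; [assumption |]; intros M [m Hm] HM.
destruct (C M HM) as [HMF H]; eauto.
Qed.

(** θ is the Hartogs number of a set u closed under pairs, which makes it regular. As u is
    transitive, the transitive closure of a subset of u stays inside u, so all subsets of u lie in H
    θ; sets of conditions can then be values of operations. The set u includes κ and ω2, which
    places them below θ. *)
Lemma exists_large_regular κ x :
  exists θ u, regular θ /\ omega2 ⊆ θ /\ (ordinal κ -> κ ∈ θ) /\ x ∈ u /\
    transitive u /\ omega1 ∈ u /\ forall y, y ⊆ u -> y ∈ H θ.
Proof.
destruct (pairing_closure (cup (cup omega2 κ) (cup omega (upair x omega1))))
  as [u [Hu [Htr Hpair]]].
assert (Hin : forall z, z ∈ omega2 \/ z ∈ κ \/ z ∈ omega \/ z = x \/ z = omega1 -> z ∈ u).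
{ intros z Hz; apply Hu; rewrite !cup_spec, upair_spec; tauto. }
exists (hartogs u), u; split; [| split; [| split; [| split; [| split; [| split]]]]]; auto 8.
- apply hartogs_regular; [intros z Hz; auto | assumption].
- apply ordinal_hartogs, hartogs_spec; split; [apply ordinal_hartogs |].
  apply card_le_sub; intros z Hz; auto.
- intro Hκ; apply hartogs_spec; split; [assumption |].
  apply card_le_sub; intros z Hz; auto.
- intros y Hy; apply H_spec, card_lt_hartogs, card_le_sub; now apply trcl_min.
Qed.

Lemma decides_somewhere P (φ : V -> V -> Prop) s X :
  GMP V -> forcing_notion P -> meets_dense P -> proper_omega1 P ->
  (forall t t' ξ, le P t' t -> φ t ξ -> φ t' ξ) ->
  (forall t ξ, t ∈ conds P -> densely_below P t (fun t' => φ t' ξ) -> φ t ξ) ->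
  s ∈ conds P -> (forall t ξ, le P t s -> φ t ξ -> ξ ∈ X) ->
  (forall a t, countable a -> le P t s -> exists t', le P t' t /\ decided P φ t' a) ->
  exists t, le P t s /\ decided P φ t X.
Proof.
intros HGMP HP HFA [κ [Hκ Hprop]] φ_mono φ_local Hs HX Hdec.
apply NNPP; intro Hn.
destruct (exists_large_regular κ (upair P X)) as
  [θ [u [Hθ [H2 [Hκθ [HPX [Htr [H1u Hsub]]]]]]]].
assert (HPu : P ∈ u) by (apply (Htr _ HPX), upair_spec; auto).
assert (HXu : X ∈ u) by (apply (Htr _ HPX), upair_spec; auto).
assert (Hcu : conds P ⊆ u).
{ apply Htr, (Htr (upair (conds P) (conds P))); [| apply upair_spec; auto].
  apply (Htr _ HPu); rewrite (P_opair HP) at 3; apply upair_spec; auto. }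
assert (Hmem : forall z, z ∈ u -> z ∈ H θ) by (intros z Hz; apply Hsub, Htr, Hz).
assert (H0 := empty_H Hθ).
(* A generic condition speaks only of dense sets that are elements of M. The ones needed are indexed
   by elements of M, so M is closed under D and E. Closure under [diff] keeps the point of
   difference in M, the only place where a guess y is known to agree with x. *)
set (D := fun a => sep (conds P) (fun r => decided P φ r a \/ ~ compatible P r s)).
set (E := fun y => sep (conds P) (fun r =>
  (exists ξ, ξ ∈ X /\ differs P φ r y ξ) \/ ~ compatible P r s)).
set (diff := fun r y => the (fun ξ => ξ ∈ X /\ differs P φ r y ξ)).
assert (F0 : operation θ (fun _ => empty)).
{ intros e _; apply P_spec; split; [intros z Hz; now apply in_empty in Hz |].
  apply card_lt_empty; exists omega1; apply hartogs_spec; split.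
  - apply ordinal_hartogs.
  - apply card_le_sub; now intros z Hz. }
destruct (@add_constant θ (fun _ => empty) P) as [F1 [HF1 C1]]; auto.
destruct (@add_constant θ F1 s) as [F2 [HF2 C2]]; auto.
destruct (@add_constant θ F2 X) as [F3 [HF3 C3]]; auto.
destruct (@add_constant θ F3 omega1) as [F4 [HF4 C4]]; auto.
destruct (@add_binary θ F4 (fun a _ => D a)) as [F5 [HF5 C5]]; [assumption | |].
{ intros a _ _ _; apply Hsub; intros r Hr; apply sep_spec in Hr; apply Hcu, Hr. }
destruct (@add_binary θ F5 (fun y _ => E y)) as [F6 [HF6 C6]]; [assumption | |].
{ intros y _ _ _; apply Hsub; intros r Hr; apply sep_spec in Hr; apply Hcu, Hr. }
(* With this operation, an approximation on a ∈ M that is decided by a condition of M is itself an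
   element of M. *)
destruct (@add_binary θ F6 (fun a r => sep a (φ r))) as [F7 [HF7 C7]]; [assumption | |].
{ intros a r Ha _; apply sub_H with a; [assumption |].
  intros ξ Hξ; now apply sep_spec in Hξ. }
destruct (@add_binary θ F7 (fun r y =>
  if excluded_middle_informative (diff r y ∈ X) then diff r y else empty))
  as [F8 [HF8 C8]]; [assumption | |].
{ intros r y _ _; destruct excluded_middle_informative as [Hd |]; [| assumption].
  apply Hmem; exact (Htr X HXu _ Hd). }
destruct (GMP_closed HGMP Hθ H2 HF8) as
  [M [Hel [HMP [Hcard [Hg [Hδ [HC8 Hctbl]]]]]]].
assert (HMne := proj1 Hel); destruct HMne as [m Hm].
destruct (C8 M HC8) as [HC7 Hdiff]; destruct (C7 M HC7) as [HC6 Hsep].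
destruct (C6 M HC6) as [HC5 HE]; destruct (C5 M HC5) as [HC4 HD].
destruct (C4 M (ex_intro _ m Hm) HC4) as [HC3 H1M].
destruct (C3 M (ex_intro _ m Hm) HC3) as [HC2 HXM].
destruct (C2 M (ex_intro _ m Hm) HC2) as [HC1 HsM].
destruct (C1 M (ex_intro _ m Hm) HC1) as [_ HPM].
(* [M ∩ omega2] is transitive, being an ordinal, and [omega1] was made an element of it. *)
assert (Hω1M : omega1 ⊆ M).
{ apply hartogs_spec in Hδ as [[Hδ _] _].
  assert (H1 : omega1 ∈ M ∩ omega2).
  { apply cap_spec; split; [assumption |]; apply hartogs_spec; split.
    - apply ordinal_hartogs.
    - apply card_le_sub; now intros z Hz. }
  intros z Hz; apply (Hδ _ H1) in Hz; now apply cap_spec in Hz. }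
destruct (Hprop θ Hθ (Hκθ Hκ) M HPM Hel Hω1M Hcard s HsM Hs) as [q [Hqs [Cq Hgen]]].
assert (φ_mono' : forall ξ, monotone P (fun _ t => φ t ξ)).
{ intros ξ t t' Ht; now apply φ_mono. }
(* Genericity of q; the conditions incompatible with s make C dense in all of P
   and are ruled out by q ≤ s. *)
assert (Hpick : forall (C : V -> Prop) t,
  sep (conds P) (fun r => C r \/ ~ compatible P r s) ∈ M ->
  (forall r, le P r s -> exists r', le P r' r /\ C r') ->
  le P t q -> exists r v, r ∈ M /\ C r /\ le P v r /\ le P v t).
{ intros C t HCM HCd Ht.
  destruct (Hgen _ HCM) with (q := t) as [r [Hr [v [L1 L2]]]]; [| assumption |].
  - split; [intros r Hr; now apply sep_spec in Hr |]; intros r Hr.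
    destruct (classic (compatible P r s)) as [[r1 [L1 L2]] | Hinc].
    + destruct (HCd r1 L2) as [r2 [L3 HC]]; exists r2.
      split; [| now apply (le_trans HP) with r1].
      apply sep_spec; split; [now apply (le_conds HP L3) | auto].
    + exists r; split; [| now apply le_refl]; apply sep_spec; auto.
  - apply cap_spec in Hr as [HrM Hr]; apply sep_spec in Hr as [_ [HC | Hinc]].
    + exists r, v; auto.
    + destruct Hinc; exists v; split; [assumption |].
      apply (le_trans HP) with t; [assumption | now apply (le_trans HP) with q]. }
destruct (@guessed_below V P HP HFA φ φ_mono' M q X) as [t [y [Ht [Hy Hnd]]]];
  auto using card_eq_le.
- intros t ξ Ht; apply HX; now apply (le_trans HP) with q.
- intros a t Ha Hc Ht.
  destruct (Hpick (fun r => decided P φ r a) t) as [r [v [HrM [Hr [L1 L2]]]]]; auto.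
  + exact (HD a m Ha Hm).
  + exists v; split; [assumption |]; split; [now apply (decided_mono HP φ_mono' L1) |].
    assert (Cr := proj2 (le_conds HP L1)).
    rewrite (decided_sep φ_mono' Cr L1 Hr); auto.
(* Below t, no condition sees a difference between x and y on M. Genericity provides r ∈ M that sees
   a difference from y at a point of M, and a common extension v of r and t is contradictory. *)
- destruct (Hpick (fun r => exists ξ, ξ ∈ X /\ differs P φ r y ξ) t)
    as [r [v [HrM [Hr [L1 L2]]]]]; auto.
  + exact (HE y m Hy Hm).
  (* If no extension of r saw a difference from y on X, then r would decide x on X, with y ∩ X as
     its value, against [Hn]. *)
  + intros r Hr; assert (Hnr : ~ decided P φ r X) by eauto.
    apply NNPP; intro Hno; apply Hnr; intros ξ Hξ.
    destruct (classic (ξ ∈ y)) as [Hξy | Hξy].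
    * left; apply φ_local; [now apply (le_conds HP Hr) |].
      intros r' Hr'; apply NNPP; intro Hno'; apply Hno; exists r'; split; [assumption |].
      exists ξ; split; [assumption |]; left; split; [assumption |].
      intros w Hw Hf; apply Hno'; eauto.
    * right; intros r' Hr' Hf; apply Hno; exists r'; split; [assumption |].
      exists ξ; split; [assumption |]; right; auto.
  + apply the_spec in Hr as [HξX Hdr]; fold (diff r y) in HξX, Hdr.
    assert (HξM := Hdiff r y HrM Hy).
    destruct excluded_middle_informative as [_ |]; [| contradiction].
    apply (Hnd v (diff r y) L2 HξM); now apply (differs_mono HP φ_mono' L1).
Qed.

Lemma approximation_of_GMP P : GMP V -> forcing_notion P -> meets_dense P ->
  proper_omega1 P -> omega1_approximation P.
Proof.
intros HGMP HP HFA Hprop p Hp x q Hq [HX Hcap] q' Hq'.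
destruct (HX q' Hq') as [s [Hs [X HxX]]].
assert (Cs := proj1 (le_conds HP Hs)).
assert (Lsq : le P s q) by now apply (le_trans HP) with q'.
set (φ := fun t ξ => f_mem (check ξ) x P t).
assert (HφX : forall t ξ, le P t s -> φ t ξ -> ξ ∈ X).
{ intros t ξ Ht Hξ; apply (check_mem_inv HP (proj1 (le_conds HP Ht))).
  exact (HxX _ t Ht Hξ). }
destruct (@decides_somewhere P φ s X) as [t [Ht Hdec]]; auto.
- intros t t' ξ Ht; now apply f_mem_mono.
- intros t ξ Ct; now apply f_mem_local.
- intros a t Hc Ht; assert (Ltq : le P t q) by now apply (le_trans HP) with s.
  destruct (Hcap a t Ltq Hc t) as [t' [Ht' [b Hb]]];
    [apply le_refl; [assumption | now apply (le_conds HP Ht)] |].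
  exists t'; split; [assumption |].
  now apply (f_cap_check_inv HP (proj1 (le_conds HP Ht'))) in Hb.
- exists t; split; [now apply (le_trans HP) with s |].
  assert (Ct := proj1 (le_conds HP Ht)).
  (* Since t decides x on X and s ≥ t forces x to be a subset of X, the elements that t puts into x
     are all that x can have. *)
  exists (sep X (φ t)); apply f_eq_ext; auto.
  + intros z u Hu Hz.
    assert (Hz' := HxX z u (le_trans HP Hu Ht) Hz).
    apply f_mem_check in Hz'; [| assumption].
    apply f_mem_check; [assumption |]; apply (densely_imp HP Hz').
    intros v Hv [j [Hj Ej]]; exists j; split; [| assumption].
    apply sep_spec; split; [assumption |].
    destruct (Hdec j Hj) as [| Hneg]; [assumption |].
    destruct (Hneg v); [now apply (le_trans HP) with u |].
    apply (f_mem_eq_l HP Ej); now apply (f_mem_mono HP Hv).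
  + intros z u Hu Hz; apply f_mem_local; [assumption | now apply (le_conds HP Hu) |].
    apply f_mem_check in Hz; [| assumption]; apply (densely_imp HP Hz).
    intros v Hv [j [Hj Ej]]; apply sep_spec in Hj as [_ Hj].
    apply (f_mem_eq_l HP (f_eq_sym HP Ej)).
    apply (f_mem_mono HP (le_trans HP Hv Hu) Hj).
Qed.

End Closure.

Theorem theorem2p7 (V : universe) (K : V -> Prop)
  (K_forcing : forall P, K P -> forcing_notion P)
  (K_restriction : restriction_closed K)
  (K_proper : forall P, K P -> proper_omega1 P)
  (K_FA : FA K omega1)
  (V_GMP : GMP V) :
  forall P, K P -> IGMP P /\ omega1_approximation P.
Proof.
intros P KP; assert (HP := K_forcing P KP).
assert (HFA := FA_meets_dense K_FA K_restriction KP HP).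
split; [now apply IGMP_of_GMP |].
now apply approximation_of_GMP; [| | | apply K_proper].
Qed.
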